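(* For each $n=0,1,2,\dots$ define the following subspaces of spin-valued polynomials (linear spans over all admissible choices of the data): \begin{align*} \mathcal T^n_0=\big\langle & f(\sigma_1,\sigma_2,\sigma_3)\Lambda|s\rangle,\; g(\sigma_1,\sigma_2,\sigma_3)\Lambda(z_1|s\rangle),\; h(\sigma_1,\sigma_2)\Lambda(z_1^2|s\rangle),\\ & \tilde h(\sigma_1,\sigma_2)\Lambda(z_1z_2|s'\rangle),\; w(\sigma_1,\sigma_2)\Lambda(z_1z_2(z_1-z_2)|s\rangle)\ \mid\ f_{33}=g_{33}=0\big\rangle,\\ \mathcal T^n_1=\big\langle & f(\sigma_1,\sigma_2,\tau_N)\Lambda|s\rangle,\; g(\sigma_1,\tau_N)\Lambda(z_1|s\rangle)\ \mid\ f_{22}=f_{NN}=g_{NN}=0\big\rangle,\\ \mathcal T^n_2=\big\langle & f(\sigma_1,\tau_{N-1},\tau_N)\Lambda|s\rangle,\; g(\tau_{N-1},\tau_N)\Lambda(z_1|s\rangle),\; \tau_N q(\sigma_1,\tau_N)\Lambda(z_1^{-1}|s\rangle)\\ & \mid\ f_{11}=f_{N-1,N-1}=g_{N-1,N-1}=q_{11}=0\big\rangle, \end{align*} where $|s\rangle\in\Sigma$, $|s'\rangle\in\Sigma'$, the functions $f,g,h,\tilde h,w,q$ are polynomials in the indicated arguments with $\deg f\le n$, $\deg g\le n-1$, $\deg h\le n-2$, $\deg\tilde h\le n-2$, $\deg w\le n-3$, $\deg q\le n-N+1$, and $\deg$ is the total degree in $\mathbf z$. Then for each $\epsilon=0,1,2$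 and all $n=0,1,\dots$ the space $\mathcal T^n_\epsilon$ is invariant under $T_\epsilon$.
   Context: $N\ge3$ is an integer, $\mathbf z=(z_1,\dots,z_N)$, $\partial_i=\partial/\partial z_i$, indices are cyclic ($z_{N+1}\equiv z_1$), all sums run from $1$ to $N$ unless stated otherwise, and $a>1/2$ is a real parameter. $\sigma_k=\sum_i z_i^k$ and $\tau_k=\sum_{i_1<\dots<i_k}z_{i_1}\cdots z_{i_k}$. For a polynomial $f$ in (some of) the variables $\sigma_1,\sigma_2,\sigma_3,\tau_{N-1},\tau_N$, subscripts denote partial derivatives: $f_k=\partial f/\partial\sigma_k$ for $k=1,2,3$, $f_k=\partial f/\partial\tau_k$ for $k=N-1,N$ (so $f_{33}=\partial^2 f/\partial\sigma_3^2$, $f_{NN}=\partial^2f/\partial\tau_N^2$, etc.). Spin space: for a fixed $M\in\frac12\mathbb N$, $\Sigma$ is the complex vector space with basis $|s_1\dots s_N\rangle$, $s_i\in\{-M,-M+1,\dots,M\}$. The symmetric group $S_N$ acts on $\Sigma$ by permuting the spin components ($\pi$ moves the component in position $k$ to position $\pi(k)$); $S_{ij}$ is the transposition of the spins $i,j$. $\Lambda$ is the projector onto states totally symmetric under simultaneous permutations of coordinates and spins (the average over $S_N$ of the simultaneous action; e.g. on $\Sigma$ itself $\Lambda=\frac1{N!}\sum_{\pi\in S_N}\pi$). For $|s\rangle\in\Sigma$ and $i\ne j$ put $$|s^{+}_{ij}\rangle=\frac1{N!}\sum_{\pi\in S_N,\ \pi(1)=i,\ \pi(2)=j}\pi(1+S_{12})|s\rangle,$$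 and define $\Sigma'=\{|s\rangle\in\Sigma : \sum_i|s^+_{i,i+1}\rangle\in\Lambda(\Sigma)\}$ (with $|s^+_{N,N+1}\rangle\equiv|s^+_{N,1}\rangle$). Operators: $K_{ij}$ exchanges the coordinates $z_i$ and $z_j$ in a function of $\mathbf z$. With $\vartheta_0(x,y)=1$, $\vartheta_1(x,y)=\frac12(x+y)$, $\vartheta_2(x,y)=xy$, $$T_\epsilon=\sum_i z_i^\epsilon\partial_i^2+2a\sum_i\frac{1}{z_i-z_{i+1}}\big(z_i^\epsilon\partial_i-z_{i+1}^\epsilon\partial_{i+1}\big)-2a\sum_i\frac{\vartheta_\epsilon(z_i,z_{i+1})}{(z_i-z_{i+1})^2}\,(1-K_{i,i+1}),$$ acting on spin-valued functions through the coordinates only. *)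

(* Defs.v *)
From HB Require Import structures.
From mathcomp Require Import all_boot all_order all_fingroup all_algebra.
From mathcomp Require Import ring.
From mathcomp Require Import generic_quotient fraction.
From mathcomp Require Import mpoly.
Set Implicit Arguments.
Unset Strict Implicit.
Unset Printing Implicit Defensive.
Import Order.TTheory GRing.Theory Num.Theory.
Local Open Scope ring_scope.

Notation "x %:F" := (@FracField.tofrac _ x) : ring_scope.

Section Fractions.
Variables (F : fieldType) (N : nat).

Definition constF (c : F) : {fraction {mpoly F[N]}} := (c%:MP)%:F.

Definition zF (i : 'I_N) : {fraction {mpoly F[N]}} := ('X_i)%:F.

(* The next two operations use the numerator and denominator picked by repr;
   fderiv_div and fperm_div show that the choice is irrelevant. *)
Definition fderiv (i : 'I_N) (x : {fraction {mpoly F[N]}}) :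
    {fraction {mpoly F[N]}} :=
  let p := \n_(repr x) in let q := \d_(repr x) in
  (p^`M(i) * q - p * q^`M(i))%:F / (q ^+ 2)%:F.

(* The substitution z_i |-> z_(s i). *)
Definition fperm (s : 'S_N) (x : {fraction {mpoly F[N]}}) :
    {fraction {mpoly F[N]}} :=
  (msym s \n_(repr x))%:F / (msym s \d_(repr x))%:F.

Lemma fracE (x : {fraction {mpoly F[N]}}) :
  x = (\n_(repr x))%:F / (\d_(repr x))%:F.
Proof.
have d0 : (\d_(repr x))%:F != 0 by rewrite tofrac_eq0 denom_ratioP.
apply: (mulIf d0); rewrite divfK //.
rewrite -{1}[x]reprK; unlock FracField.tofrac.
rewrite !piE /FracField.mulf; apply/eqP; rewrite FracField.equivf_def.
rewrite /FracField.equivf !numden_Ratio ?mulr1 ?oner_eq0 ?denom_ratioP //.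
by rewrite mulrC.
Qed.

Lemma frac_cross (p q : {mpoly F[N]}) : q != 0 ->
  \n_(repr (p%:F / q%:F)) * q = p * \d_(repr (p%:F / q%:F)).
Proof.
move=> q0; apply/eqP; rewrite -tofrac_eq !tofracM.
by rewrite -eqr_div ?tofrac_eq0 ?denom_ratioP // -fracE.
Qed.

Lemma fderiv_div i (p q : {mpoly F[N]}) : q != 0 ->
  fderiv i (p%:F / q%:F) = (p^`M(i) * q - p * q^`M(i))%:F / (q ^+ 2)%:F.
Proof.
move=> q0; have := frac_cross p q0; rewrite /fderiv.
set x := p%:F / q%:F; set u := \n_(repr x); set v := \d_(repr x) => e.
have v0 : v != 0 := denom_ratioP _.
have de : u^`M(i) * q + u * q^`M(i) = p^`M(i) * v + p * v^`M(i).
  by rewrite -!mderivM e.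
apply/eqP; rewrite eqr_div ?tofrac_eq0 ?expf_neq0 // -!tofracM tofrac_eq.
apply/eqP.
transitivity ((u^`M(i) * q + u * q^`M(i)) * q * v
              - (u * q) * (q^`M(i) * v + q * v^`M(i))); first by ring.
by rewrite de e; ring.
Qed.

Lemma fperm_div s (p q : {mpoly F[N]}) : q != 0 ->
  fperm s (p%:F / q%:F) = (msym s p)%:F / (msym s q)%:F.
Proof.
have s0 (r : {mpoly F[N]}) : r != 0 -> msym s r != 0.
  by move=> r0; rewrite -(msym0 _ s) (inj_eq (@inj_msym _ _ s)).
move=> q0; have e := frac_cross p q0; rewrite /fperm.
apply/eqP; rewrite eqr_div ?tofrac_eq0 ?s0 ?denom_ratioP //.
by rewrite -!tofracM tofrac_eq -!msymM e.
Qed.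

(* deg p <= d, with deg 0 = -oo; d may be negative. *)
Definition deg_le (p : {mpoly F[N]}) (d : int) : Prop :=
  p != 0 -> (msize p).-1%:Z <= d.

Definition sigma (k : nat) : {mpoly F[N]} := \sum_(i < N) 'X_i ^+ k.

Definition tau (k : nat) : {mpoly F[N]} := mesym N F k.

Definition d2 (k : nat) (j : 'I_k) (p : {mpoly F[k]}) : {mpoly F[k]} :=
  p^`M(j)^`M(j).

End Fractions.

Section Spin.
Variables (F : fieldType) (N m : nat).

Local Notation K := {fraction {mpoly F[N]}}.

(* m = 2M, and k : 'I_m.+1 stands for the spin value k - M. *)
Definition config : finType := {ffun 'I_N -> 'I_m.+1}.

Definition Sigma := {ffun config -> F^o}.

(* Spin-valued rational functions of z, by their coordinates in the basis of
   spin configurations. *)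
Definition wave := {ffun config -> K^o}.

(* p maps the basis vector t to t \o p^-1, i.e., it moves the component in
   position k to position p k; hence the coordinate of p phi at t is that of
   phi at t \o p. *)
Definition spin_perm (V : Type) (p : 'S_N) (phi : {ffun config -> V}) :
    {ffun config -> V} :=
  [ffun t : config => phi [ffun k => t (p k)]].

Definition LambdaSigma (s : Sigma) : Sigma :=
  (N`!%:R^-1 : F) *: \sum_(p : 'S_N) (spin_perm p s : Sigma).

Definition Lambda (phi : wave) : wave :=
  constF N (N`!%:R^-1 : F) *:
  \sum_(p : 'S_N) ([ffun t => fperm p (spin_perm p phi t)] : wave).

Definition tens (x : K) (s : Sigma) : wave :=
  [ffun t => x * constF N (s t)].

Definition theta (eps : nat) (x y : K) : K :=
  match eps with
  | 0 => 1
  | 1 => (x + y) / 2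
  | _ => x * y
  end.

Local Notation z := (zF F).
Local Notation nxt := (@ordS N).

Definition Tscalar (a : F) (eps : nat) (x : K) : K :=
  \sum_(i < N) z i ^+ eps * fderiv i (fderiv i x)
  + 2 * constF N a *
    \sum_(i < N) (z i - z (nxt i))^-1 *
       (z i ^+ eps * fderiv i x - z (nxt i) ^+ eps * fderiv (nxt i) x)
  - 2 * constF N a *
    \sum_(i < N) theta eps (z i) (z (nxt i)) / (z i - z (nxt i)) ^+ 2 *
       (x - fperm (tperm i (nxt i)) x).

Definition Top (a : F) (eps : nat) (phi : wave) : wave :=
  [ffun t => Tscalar a eps (phi t)].

Definition Fspan (G : wave -> Prop) (phi : wave) : Prop :=
  exists (k : nat) (c : 'I_k -> F) (v : 'I_k -> wave),
    (forall i, G (v i)) /\ phi = \sum_(i < k) constF N (c i) *: v i.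

Hypothesis hN : (2 < N)%N.

Definition pos1 : 'I_N := Ordinal (ltnW (ltnW hN)).
Definition pos2 : 'I_N := Ordinal (ltnW hN).

Definition splus (i j : 'I_N) (s : Sigma) : Sigma :=
  (N`!%:R^-1 : F) *:
  \sum_(p : 'S_N | (p pos1 == i) && (p pos2 == j))
     (spin_perm p (s + spin_perm (tperm pos1 pos2) s) : Sigma).

Definition Sigma' (s : Sigma) : Prop :=
  exists u : Sigma, \sum_(i < N) splus i (nxt i) s = LambdaSigma u.

Local Notation z1 := (z pos1).
Local Notation z2 := (z pos2).
Local Notation sg := (sigma F N).
Local Notation ta := (tau F N).

(* Degrees are taken in z, after substitution; the derivatives d2 (inord j)
   are with respect to the j-th formal argument, counted from 0. *)
Inductive gen0 (n : int) : wave -> Prop :=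
| Gen0f (f : {mpoly F[3]}) (s : Sigma) :
    let fz := f \mPo [tuple sg 1; sg 2; sg 3] in
    d2 (inord 2) f = 0 -> deg_le fz n ->
    gen0 n (fz%:F *: Lambda (tens 1 s))
| Gen0g (g : {mpoly F[3]}) (s : Sigma) :
    let gz := g \mPo [tuple sg 1; sg 2; sg 3] in
    d2 (inord 2) g = 0 -> deg_le gz (n - 1) ->
    gen0 n (gz%:F *: Lambda (tens z1 s))
| Gen0h (h : {mpoly F[2]}) (s : Sigma) :
    let hz := h \mPo [tuple sg 1; sg 2] in
    deg_le hz (n - 2) ->
    gen0 n (hz%:F *: Lambda (tens (z1 ^+ 2) s))
| Gen0h' (h : {mpoly F[2]}) (s : Sigma) :
    let hz := h \mPo [tuple sg 1; sg 2] in
    Sigma' s -> deg_le hz (n - 2) ->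
    gen0 n (hz%:F *: Lambda (tens (z1 * z2) s))
| Gen0w (w : {mpoly F[2]}) (s : Sigma) :
    let wz := w \mPo [tuple sg 1; sg 2] in
    deg_le wz (n - 3) ->
    gen0 n (wz%:F *: Lambda (tens (z1 * z2 * (z1 - z2)) s)).

Inductive gen1 (n : int) : wave -> Prop :=
| Gen1f (f : {mpoly F[3]}) (s : Sigma) :
    let fz := f \mPo [tuple sg 1; sg 2; ta N] in
    d2 (inord 1) f = 0 -> d2 (inord 2) f = 0 -> deg_le fz n ->
    gen1 n (fz%:F *: Lambda (tens 1 s))
| Gen1g (g : {mpoly F[2]}) (s : Sigma) :
    let gz := g \mPo [tuple sg 1; ta N] in
    d2 (inord 1) g = 0 -> deg_le gz (n - 1) ->
    gen1 n (gz%:F *: Lambda (tens z1 s)).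

Inductive gen2 (n : int) : wave -> Prop :=
| Gen2f (f : {mpoly F[3]}) (s : Sigma) :
    let fz := f \mPo [tuple sg 1; ta N.-1; ta N] in
    d2 (inord 0) f = 0 -> d2 (inord 1) f = 0 -> deg_le fz n ->
    gen2 n (fz%:F *: Lambda (tens 1 s))
| Gen2g (g : {mpoly F[2]}) (s : Sigma) :
    let gz := g \mPo [tuple ta N.-1; ta N] in
    d2 (inord 0) g = 0 -> deg_le gz (n - 1) ->
    gen2 n (gz%:F *: Lambda (tens z1 s))
| Gen2q (q : {mpoly F[2]}) (s : Sigma) :
    let qz := q \mPo [tuple sg 1; ta N] in
    d2 (inord 0) q = 0 -> deg_le qz (n - N%:Z + 1) ->
    gen2 n ((ta N * qz)%:F *: Lambda (tens z1^-1 s)).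

Definition Tspace (eps : nat) (n : int) : wave -> Prop :=
  Fspan (match eps with 0 => gen0 n | 1 => gen1 n | _ => gen2 n end).

End Spin.

(* Main.v *)
(** [T] acts on the coordinates only, so on a generator
    [f Lambda(x|s>)] it is enough to compute [T (f (p x))] for each permutation
    [p].  For symmetric [f] one has
    [T (f x) = T f x + f T x + 2 Gam f x] with [Gam f x = sum_i z_i^eps d_i f d_i x].
    By the chain rule [T] becomes a second-order differential operator on
    polynomials in the symmetric generators; its coefficients are again
    polynomials in the generators, because the only problematic second
    derivatives are those assumed to vanish, and it raises neither the degree in
    [z] nor the degree in the restricted variables.  For the short list of
    monomials [x] the poles at [z_i = z_(i+1)] of the drift and exchange terms
    cancel pair by pair, except for [T (z_k z_l) = -2a] when [k] and [l] are
    neighbours ([eps = 0]): that term is the sum of the [s^+_(i,i+1)], which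
    [Sigma'] requires to be symmetric. *)
Require Import Defs.
From HB Require Import structures.
From mathcomp Require Import all_boot all_order all_fingroup all_algebra.
From mathcomp Require Import generic_quotient fraction ring zify.
From mathcomp Require Import reals complex mpoly.
Set Implicit Arguments.
Unset Strict Implicit.
Unset Printing Implicit Defensive.
Import Order.TTheory GRing.Theory Num.Theory.
Local Open Scope ring_scope.

(** Degree bounds concern the polynomial in z after substitution, whereas derivatives act on the
    formal polynomial, whose terms of too high weight may cancel on substitution. These terms are
    discarded first ([truncation]), so that the bound becomes one on the formal weighted degree. The
    other restrictions have the same shape: a vanishing second derivative means degree at most 1 in
    a variable, a missing argument means degree 0. All are bounds [wle] for suitable weights, and
    one lemma per epsilon shows that T respects them. The vanishing derivatives belong to the
    pairings [Gam] that for general N are not polynomials in the generators: Gam(sigma_3, sigma_3) =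
    9 sigma_4 for epsilon = 0; Gam(sigma_2, sigma_2) = 4 sigma_3 and Gam(tau_N, tau_N) = tau_(N-1)
    tau_N for epsilon = 1; Gam(sigma_1, sigma_1) = sigma_2 and Gam(tau_(N-1), tau_(N-1)), which
    involves tau_N^2 sum_i z_i^-2, for epsilon = 2. Missing arguments likewise keep out monomials
    that [Gam] with z_k would create, such as z_k^3 from a factor h depending on sigma_3. *)

Lemma mderivXU (R : nzRingType) (k : nat) (i j : 'I_k) :
  ('X_j : {mpoly R[k]})^`M(i) = (j == i)%:R.
Proof.
rewrite mderivX mnm1E; case: eqP => [->|_]; last by rewrite scale0r.
by rewrite -{1}[mnm1 _]add0m addmK mpolyX0 scale1r.
Qed.

Lemma frac_sub (L : fieldType) (p q r t : L) : q != 0 -> t != 0 ->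
  p / q - r / t = (p * t - r * q) / (q * t).
Proof. by move=> q0 t0; field; apply/andP. Qed.

(** [dp], [dq], [dr], [dt] stand for derivatives. With these as free variables, additivity of the
    quotient rule is a rational identity over any field. *)
Lemma frac_der_sub (L : fieldType) (p q r t dp dq dr dt : L) : q != 0 -> t != 0 ->
  ((dp * t + p * dt - (dr * q + r * dq)) * (q * t)
    - (p * t - r * q) * (dq * t + q * dt)) / (q * t) ^+ 2 =
  (dp * q - p * dq) / q ^+ 2 - (dr * t - r * dt) / t ^+ 2.
Proof. by move=> q0 t0; field; apply/andP. Qed.

Lemma frac_der_mul (L : fieldType) (p q r t dp dq dr dt : L) : q != 0 -> t != 0 ->
  ((dp * r + p * dr) * (q * t) - p * r * (dq * t + q * dt)) / (q * t) ^+ 2 =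
  (dp * q - p * dq) / q ^+ 2 * (r / t) + p / q * ((dr * t - r * dt) / t ^+ 2).
Proof. by move=> q0 t0; field; apply/andP. Qed.

(** * Derivations and permutations of the rational functions *)

Section FractionCalculus.
Variables (F : fieldType) (N : nat).
Implicit Types (p q : {mpoly F[N]}) (x y : {fraction {mpoly F[N]}}).
Implicit Types (i j : 'I_N) (s : 'S_N).
Local Notation K := {fraction {mpoly F[N]}}.
Local Notation z := (@zF F N).

(** With explicit quotients, rules for [fderiv] and [fperm] follow from [fderiv_div] and
    [fperm_div], whatever representative [repr] picks. *)
Lemma frac_ind (P : K -> Prop) :
  (forall p q, q != 0 -> P (p%:F / q%:F)) -> forall x, P x.
Proof. by move=> PE x; rewrite [x]fracE; apply/PE/denom_ratioP. Qed.

Lemma fderiv_tofrac i p : fderiv i p%:F = (p^`M(i))%:F.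
Proof.
have := fderiv_div i p (oner_neq0 _); rewrite !tofrac1 !divr1 => ->.
by rewrite -mpolyC1 mderivC expr1n mulr1 mulr0 subr0 tofrac1 divr1.
Qed.

Lemma fperm_tofrac s p : fperm s p%:F = (msym s p)%:F.
Proof.
by have := fperm_div s p (oner_neq0 _); rewrite msym1 !tofrac1 !divr1.
Qed.

Lemma fderiv_is_additive i : zmod_morphism (@fderiv F N i).
Proof.
elim/frac_ind=> p q q0; elim/frac_ind=> r t t0.
have q0' : q%:F != 0 :> K by rewrite tofrac_eq0.
have t0' : t%:F != 0 :> K by rewrite tofrac_eq0.
have -> : p%:F / q%:F - r%:F / t%:F = (p * t - r * q)%:F / (q * t)%:F :> K.
  rewrite (tofracB (p * t)) (tofracM p t) (tofracM r q) (tofracM q t).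
  exact: (frac_sub p%:F r%:F q0' t0').
rewrite (fderiv_div _ _ q0) (fderiv_div _ _ t0) fderiv_div ?mulf_neq0 //.
rewrite mderivB !mderivM.
rewrite !tofracXn !tofracB !tofracM !tofracB !tofracD !tofracM.
exact: (frac_der_sub p%:F r%:F (p^`M(i))%:F (q^`M(i))%:F (r^`M(i))%:F (t^`M(i))%:F q0' t0').
Qed.

HB.instance Definition _ i :=
  GRing.isZmodMorphism.Build K K (@fderiv F N i) (fderiv_is_additive i).

Lemma fderivB i x y : fderiv i (x - y) = fderiv i x - fderiv i y.
Proof. exact: raddfB. Qed.

Lemma fderivD i x y : fderiv i (x + y) = fderiv i x + fderiv i y.
Proof. exact: raddfD. Qed.

Lemma fderiv0 i : fderiv i (0 : {fraction {mpoly F[N]}}) = 0.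
Proof. exact: raddf0. Qed.

Lemma fderivM i x y : fderiv i (x * y) = fderiv i x * y + x * fderiv i y.
Proof.
move: x y; elim/frac_ind=> p q q0; elim/frac_ind=> r t t0.
have q0' : q%:F != 0 :> K by rewrite tofrac_eq0.
have t0' : t%:F != 0 :> K by rewrite tofrac_eq0.
rewrite mulf_div -!tofracM (fderiv_div _ _ q0) (fderiv_div _ _ t0).
rewrite fderiv_div ?mulf_neq0 // !mderivM.
rewrite !tofracXn !tofracB !tofracM !tofracD !tofracM.
exact: (frac_der_mul p%:F r%:F (p^`M(i))%:F (q^`M(i))%:F (r^`M(i))%:F (t^`M(i))%:F q0' t0').
Qed.

Lemma fperm_is_additive s : zmod_morphism (@fperm F N s).
Proof.
elim/frac_ind=> p q q0; elim/frac_ind=> r t t0.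
have q0' : q%:F != 0 :> K by rewrite tofrac_eq0.
have t0' : t%:F != 0 :> K by rewrite tofrac_eq0.
have s0 (u : {mpoly F[N]}) : u != 0 -> (msym s u)%:F != 0 :> K.
  by rewrite tofrac_eq0; apply: contra_neq => e; apply: (@inj_msym _ _ s); rewrite e msym0.
have -> : p%:F / q%:F - r%:F / t%:F = (p * t - r * q)%:F / (q * t)%:F :> K.
  rewrite (tofracB (p * t)) (tofracM p t) (tofracM r q) (tofracM q t).
  exact: (frac_sub p%:F r%:F q0' t0').
rewrite (fperm_div _ _ q0) (fperm_div _ _ t0) fperm_div ?mulf_neq0 //.
rewrite msymB !msymM tofracB.
rewrite (tofracM (msym s p) (msym s t)) (tofracM (msym s r) (msym s q)).
rewrite (tofracM (msym s q) (msym s t)).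
apply/esym; exact: (frac_sub (msym s p)%:F (msym s r)%:F (s0 _ q0) (s0 _ t0)).
Qed.

Lemma fperm_is_multiplicative s : monoid_morphism (@fperm F N s).
Proof.
split; first by rewrite -tofrac1 fperm_tofrac msym1.
elim/frac_ind=> p q q0; elim/frac_ind=> r t t0.
rewrite mulf_div -!tofracM (fperm_div _ _ q0) (fperm_div _ _ t0).
by rewrite fperm_div ?mulf_neq0 // !msymM !tofracM mulf_div.
Qed.

HB.instance Definition _ s :=
  GRing.isZmodMorphism.Build K K (@fperm F N s) (fperm_is_additive s).
HB.instance Definition _ s :=
  GRing.isMonoidMorphism.Build K K (@fperm F N s) (fperm_is_multiplicative s).

Lemma fpermM s x y : fperm s (x * y) = fperm s x * fperm s y.
Proof. exact: rmorphM. Qed.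

Lemma fpermB s x y : fperm s (x - y) = fperm s x - fperm s y.
Proof. exact: raddfB. Qed.

Lemma constF_is_additive : zmod_morphism (@constF F N).
Proof. by move=> c d; rewrite /constF mpolyCB tofracB. Qed.

Lemma constF_is_multiplicative : monoid_morphism (@constF F N).
Proof. by split=> [|c d]; rewrite /constF ?mpolyC1 ?tofrac1 // mpolyCM tofracM. Qed.

HB.instance Definition _ :=
  GRing.isZmodMorphism.Build F K (@constF F N) constF_is_additive.
HB.instance Definition _ :=
  GRing.isMonoidMorphism.Build F K (@constF F N) constF_is_multiplicative.

Lemma fderiv_const i (c : F) : fderiv i (constF N c) = 0.
Proof. by rewrite /constF fderiv_tofrac mderivC rmorph0. Qed.

Lemma fperm_const s (c : F) : fperm s (constF N c) = constF N c.
Proof. by rewrite /constF fperm_tofrac -[c%:MP]mulr1 mul_mpolyC msymZ msym1. Qed.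

Lemma fderiv1 i : fderiv i (1 : K) = 0.
Proof. by rewrite -(rmorph1 (@constF F N)) fderiv_const. Qed.

Lemma fderiv_nat i n : fderiv i (n%:R : K) = 0.
Proof. by rewrite raddfMn /= fderiv1 mul0rn. Qed.

Lemma fderiv_z i j : fderiv i (z j) = (j == i)%:R.
Proof. by rewrite /zF fderiv_tofrac mderivXU rmorph_nat. Qed.

Lemma fperm_z s i : fperm s (z i) = z (s i).
Proof.
rewrite /zF fperm_tofrac msymX; congr (mpolyX _ _)%:F.
apply/mnmP=> j; rewrite mnmE !mnm1E; congr nat_of_bool.
by rewrite -(inj_eq (@perm_inj _ s)) permKV.
Qed.

Lemma z_neq0 i : z i != 0.
Proof. by rewrite tofrac_eq0 -msize_poly_eq0 msizeX. Qed.

Lemma z_sub_neq0 i j : i != j -> z i - z j != 0.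
Proof.
move=> ij; rewrite subr_eq0 tofrac_eq; apply: contra_neq ij => e.
have := congr1 (mcoeff U_(i)) e; rewrite !mcoeffX eqxx eq_mnm1 eq_sym.
by case: eqP => // _ /eqP; rewrite oner_eq0.
Qed.

Lemma fderivV i x : x != 0 -> fderiv i x^-1 = - fderiv i x / x ^+ 2.
Proof.
move=> x0; have := fderivM i x x^-1; rewrite divff // fderiv1.
move/eqP; rewrite eq_sym addrC addr_eq0 => /eqP e.
by apply: (mulfI x0); rewrite e expr2 invfM mulrCA mulVKf // mulNr.
Qed.

End FractionCalculus.

Lemma eps3_ind (P : nat -> Prop) : P 0 -> P 1 -> P 2 ->
  forall e, (e < 3)%N -> P e.
Proof. by move=> P0 P1 P2 [|[|[|]]]. Qed.

(** * The action of a single bond *)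

Section PairIdentities.
Variable L : fieldType.
Implicit Types x y w : L.

(* [pair_op] below is this expression with [dx], [dy] the two derivatives of [f]
   and [g] the function [f] with its two coordinates exchanged. *)
Definition pair_expr eps x y dx dy f g : L :=
  (x - y)^-1 * (x ^+ eps * dx - y ^+ eps * dy)
  - nth 0 [:: 1; (x + y) / 2; x * y] eps / (x - y) ^+ 2 * (f - g).

(** A bond has no orientation; the monomial lemmas use this to assume that a given site is not its
    second end. *)
Lemma pair_expr_sym eps x y dx dy f g : (eps < 3)%N ->
  pair_expr eps y x dy dx f g = pair_expr eps x y dx dy f g.
Proof.
rewrite /pair_expr -(opprB x y) invrN sqrrN mulNr -mulrN opprB.
by case: eps => [|[|[|//]]] _ /=; rewrite 1?[y + x]addrC 1?[y * x]mulrC.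
Qed.

Lemma pair_exprN eps x y dx dy f g :
  pair_expr eps x y (- dx) (- dy) (- f) (- g) = - pair_expr eps x y dx dy f g.
Proof. by rewrite /pair_expr; move: (x - y) => d; ring. Qed.

Lemma pair_expr0 eps x y f : pair_expr eps x y 0 0 f f = 0.
Proof. by rewrite /pair_expr !mulr0 !subrr !mulr0 subrr. Qed.

Lemma pair_expr_z eps x y : 2 != 0 :> L -> x - y != 0 -> (eps < 3)%N ->
  pair_expr eps x y 1 0 x y = nth 0 [:: 0; 2^-1; x] eps.
Proof.
move=> t0 d0; rewrite /pair_expr.
by case: eps => [|[|[|//]]] _ /=; field; rewrite ?t0.
Qed.

Lemma pair_expr_zz x y : x - y != 0 -> pair_expr 0 x y y x (x * y) (y * x) = -1.
Proof. by move=> d0; rewrite /pair_expr /=; field. Qed.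

Lemma pair_expr_zz1 x y w : x - y != 0 -> pair_expr 0 x y w 0 (x * w) (y * w) = 0.
Proof. by move=> d0; rewrite /pair_expr /=; field. Qed.

Lemma pair_expr_sqr x y : x - y != 0 -> pair_expr 0 x y (x + x) 0 (x ^+ 2) (y ^+ 2) = 1.
Proof. by move=> d0; rewrite /pair_expr /=; field. Qed.

Lemma pair_expr_cubic x y : x - y != 0 ->
  pair_expr 0 x y (y * (x - y) + x * y) (x * (x - y) - x * y)
    (x * y * (x - y)) (y * x * (y - x)) = y - x.
Proof. by move=> d0; rewrite /pair_expr /=; field. Qed.

Lemma pair_expr_cubic1 x y w : x - y != 0 ->
  pair_expr 0 x y (w * (x - w) + x * w) 0 (x * w * (x - w)) (y * w * (y - w)) = w.
Proof. by move=> d0; rewrite /pair_expr /=; field. Qed.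

Lemma pair_expr_inv x y : x != 0 -> y != 0 -> x - y != 0 ->
  pair_expr 2 x y (- 1 / x ^+ 2) 0 x^-1 y^-1 = 0.
Proof. by move=> x0 y0 d0; rewrite /pair_expr /=; field; rewrite d0 x0 y0. Qed.

End PairIdentities.

Section Operator.
Variables (F : numFieldType) (N : nat).
Local Notation K := {fraction {mpoly F[N]}}.
Local Notation z := (@zF F N).
Local Notation nxt := (@ordS N).
Implicit Types (x y f : K) (i j k l : 'I_N).

Definition pair_op eps i j x : K :=
  (z i - z j)^-1 * (z i ^+ eps * fderiv i x - z j ^+ eps * fderiv j x)
  - theta eps (z i) (z j) / (z i - z j) ^+ 2 * (x - fperm (tperm i j) x).

Definition Gam eps x y : K := \sum_i z i ^+ eps * fderiv i x * fderiv i y.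

Definition Lap eps x : K := \sum_i z i ^+ eps * fderiv i (fderiv i x).

Definition pair_sum eps x : K := \sum_i pair_op eps i (nxt i) x.

Lemma TscalarE (a : F) eps x :
  Tscalar a eps x = Lap eps x + 2 * constF N a * pair_sum eps x.
Proof. by rewrite /Tscalar /pair_sum sumrB mulrBr addrA. Qed.

Lemma Lap_is_additive eps : zmod_morphism (Lap eps).
Proof.
move=> x y; rewrite /Lap -sumrB; apply: eq_bigr => i _.
by rewrite !fderivB mulrBr.
Qed.

HB.instance Definition _ eps :=
  GRing.isZmodMorphism.Build K K (Lap eps) (Lap_is_additive eps).

Lemma pair_sum_is_additive eps : zmod_morphism (pair_sum eps).
Proof.
move=> x y; rewrite /pair_sum -sumrB; apply: eq_bigr => i _; rewrite /pair_op.
rewrite !fderivB fpermB.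
move: (fderiv _ x) (fderiv _ x) (fderiv _ y) (fderiv _ y).
move: (fperm _ x) (fperm _ y) (_ - _)^-1 (_ / _) (_ ^+ eps) (_ ^+ eps).
by move=> *; ring.
Qed.

HB.instance Definition _ eps :=
  GRing.isZmodMorphism.Build K K (pair_sum eps) (pair_sum_is_additive eps).

Lemma Tscalar_is_additive (a : F) eps : zmod_morphism (@Tscalar F N a eps).
Proof.
move=> x y; rewrite !TscalarE (raddfB (Lap eps)) (raddfB (pair_sum eps)) mulrBr.
by rewrite opprD addrACA.
Qed.

HB.instance Definition _ a eps :=
  GRing.isZmodMorphism.Build K K (@Tscalar F N a eps) (Tscalar_is_additive a eps).

Lemma LapM eps x y :
  Lap eps (x * y) = Lap eps x * y + x * Lap eps y + 2 * Gam eps x y.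
Proof.
rewrite /Lap /Gam mulr_suml !mulr_sumr -!big_split; apply: eq_bigr => i _ /=.
rewrite (fderivM i x y) fderivD.
rewrite (fderivM i (fderiv i x) y) (fderivM i x (fderiv i y)).
ring.
Qed.

(** A symmetric [f] factors out of the exchange term, so on [f] each bond acts as a first-order
    derivation. *)
Lemma pair_sumM eps f x : (forall s, fperm s f = f) ->
  pair_sum eps (f * x) = pair_sum eps f * x + f * pair_sum eps x.
Proof.
move=> fs; rewrite /pair_sum mulr_suml mulr_sumr -big_split; apply: eq_bigr => i _.
rewrite /pair_op (fderivM i f x) (fderivM (nxt i) f x) fpermM fs /=.
ring.
Qed.

Lemma TscalarM (a : F) eps f x : (forall s, fperm s f = f) ->
  Tscalar a eps (f * x) =
    Tscalar a eps f * x + f * Tscalar a eps x + 2 * Gam eps f x.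
Proof.
move=> fs; rewrite !TscalarE LapM pair_sumM //.
move: (constF N a) (Lap _ _) (Lap _ _) (Gam _ _ _) (pair_sum _ _) (pair_sum _ _).
by move=> *; ring.
Qed.

Lemma Tscalar_const (a c : F) eps : Tscalar a eps (constF N c) = 0.
Proof.
rewrite TscalarE /Lap /pair_sum !big1 ?mulr0 ?addr0 // => i _; rewrite /pair_op ?fderiv_const.
  by rewrite fperm_const subrr !mulr0 subrr mulr0 subr0.
by rewrite mulr0.
Qed.

Lemma TscalarMl (a c : F) eps x :
  Tscalar a eps (constF N c * x) = constF N c * Tscalar a eps x.
Proof.
rewrite TscalarM => [|s]; last exact: fperm_const.
rewrite Tscalar_const mul0r add0r /Gam big1 ?mulr0 ?addr0 // => i _.
by rewrite fderiv_const mulr0 mul0r.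
Qed.

Lemma two_neq0 : 2 != 0 :> K.
Proof. by rewrite -(rmorph_nat (@constF F N)) fmorph_eq0 pnatr_eq0. Qed.

Definition simp01 := (@mulr0n K, @mulr1n K, @mulr0 K, @mul0r K, @mulr1 K, @mul1r K,
  @addr0 K, @add0r K, @subr0 K, @sub0r K, @oppr0 K).

Lemma pair_opE eps i j x : (eps < 3)%N ->
  pair_op eps i j x =
    pair_expr eps (z i) (z j) (fderiv i x) (fderiv j x) x (fperm (tperm i j) x).
Proof.
by move: eps; apply: eps3_ind; rewrite /pair_op /pair_expr /theta /=; reflexivity.
Qed.

Lemma pair_op_sym eps i j x : (eps < 3)%N -> pair_op eps j i x = pair_op eps i j x.
Proof.
move=> e3.
rewrite (pair_opE j i x e3).
rewrite (pair_opE i j x e3).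
rewrite tpermC.
exact: pair_expr_sym.
Qed.

Lemma pair_op_z eps i j k : (eps < 3)%N -> i != j ->
  pair_op eps i j (z k) = ((k == i)%:R + (k == j)%:R)
     * nth 0 [:: 0; 2^-1; z k] eps.
Proof.
move=> eps3; wlog kj : i j / k != j => [th|] ij.
  have /orP[/eqP kj|kj] := orbN (k == j); last exact: th.
  rewrite -(pair_op_sym i j) // addrC; apply: th; rewrite 1?eq_sym //.
  by rewrite kj.
rewrite pair_opE // !fderiv_z fperm_z (negPf kj) addr0.
have [->|ki] := eqVneq k i.
  rewrite tpermL !simp01.
  exact: pair_expr_z (two_neq0) (z_sub_neq0 _ ij) eps3.
by rewrite tpermD 1?eq_sym // !simp01 pair_expr0.
Qed.

Lemma sum_delta k (c : 'I_N -> K) : \sum_i (k == i)%:R * c i = c k.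
Proof.
rewrite (bigD1 k) //= eqxx mul1r big1 ?addr0 // => i.
by rewrite eq_sym => /negPf->; rewrite mul0r.
Qed.

Lemma sum_nxt (c : 'I_N -> K) : \sum_i c (nxt i) = \sum_i c i.
Proof. by rewrite [RHS](reindex_inj (@ordS_inj N)). Qed.

(** On the cyclic chain each site is the first end of one bond and the second end of another. With
    the prefactor 2a this gives the constants 4a below. *)
Lemma sum_nbr k (c : K) :
  \sum_i ((k == i)%:R + (k == nxt i)%:R) * c = 2 * c.
Proof.
under eq_bigr do rewrite mulrDl.
rewrite big_split (sum_nxt (fun i => (k == i)%:R * c)) /=.
by rewrite (sum_delta k (fun=> c)) mulrDl mul1r.
Qed.

Lemma nxt_neq i : (1 < N)%N -> i != nxt i.
Proof.
move=> N1; rewrite -val_eqE /=; have [iN|] := ltnP i.+1 N.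
  by rewrite modn_small // ltn_eqF.
(* The last site wraps around to 0, which differs from N - 1 because N > 1. *)
move=> Ni; have -> : i.+1 = N by apply/eqP; rewrite eqn_leq Ni ltn_ord.
by rewrite modnn; case: (i : nat) Ni N1 => // ; lia.
Qed.

Lemma Lap_z eps k : Lap eps (z k) = 0.
Proof.
by apply: big1 => i _; rewrite fderiv_z fderiv_nat mulr0.
Qed.

Lemma Tscalar_z (a : F) eps k : (1 < N)%N -> (eps < 3)%N ->
  Tscalar a eps (z k) = 4 * constF N a * nth 0 [:: 0; 2^-1; z k] eps.
Proof.
move=> N1 eps3; rewrite TscalarE Lap_z add0r /pair_sum.
rewrite (eq_bigr (fun i => ((k == i)%:R + (k == nxt i)%:R) * nth 0 [:: 0; 2^-1; z k] eps)).
  by rewrite sum_nbr; ring.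
by move=> i _; rewrite pair_op_z ?nxt_neq.
Qed.

Lemma pair_op_far eps i j x : (eps < 3)%N -> fderiv i x = 0 -> fderiv j x = 0 ->
  fperm (tperm i j) x = x -> pair_op eps i j x = 0.
Proof. by move=> e3 xi xj xij; rewrite pair_opE // xi xj xij pair_expr0. Qed.

Lemma pair_op_sqr i j k : i != j ->
  pair_op 0 i j (z k ^+ 2) = (k == i)%:R + (k == j)%:R.
Proof.
have D h : fderiv h (z k ^+ 2) = (k == h)%:R * z k + z k * (k == h)%:R.
  by rewrite expr2 fderivM fderiv_z.
have P s : fperm s (z k ^+ 2) = z (s k) ^+ 2 by rewrite expr2 fpermM fperm_z.
wlog kj : i j / k != j => [th|] ij.
  have /orP[/eqP kj|kj] := orbN (k == j); last exact: th.
  rewrite -(pair_op_sym i j) // addrC; apply: th; rewrite 1?eq_sym //.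
  by rewrite kj.
have /orP[/eqP ki|ki] := orbN (k == i).
  subst k; rewrite pair_opE // !D P tpermL eqxx (negPf ij) !simp01.
  by rewrite pair_expr_sqr ?z_sub_neq0.
rewrite (negPf ki) (negPf kj) !simp01; apply: pair_op_far => //.
- by rewrite D (negPf ki) !simp01.
- by rewrite D (negPf kj) !simp01.
by rewrite P tpermD // eq_sym.
Qed.

Section TwoIndices.
Variables k l : 'I_N.
Hypothesis kl : k != l.

Lemma fderiv_zz h : fderiv h (z k * z l) = (k == h)%:R * z l + z k * (l == h)%:R.
Proof. by rewrite fderivM !fderiv_z. Qed.

Lemma fderiv_cubic h : fderiv h (z k * z l * (z k - z l)) =
  ((k == h)%:R * z l + z k * (l == h)%:R) * (z k - z l)
  + z k * z l * ((k == h)%:R - (l == h)%:R).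
Proof. by rewrite fderivM fderiv_zz fderivB !fderiv_z. Qed.

Lemma fperm_zz s : fperm s (z k * z l) = z (s k) * z (s l).
Proof. by rewrite fpermM !fperm_z. Qed.

Lemma fperm_cubic s : fperm s (z k * z l * (z k - z l)) =
  z (s k) * z (s l) * (z (s k) - z (s l)).
Proof. by rewrite fpermM fperm_zz fpermB !fperm_z. Qed.

Lemma pair_op_near : (pair_op 0 k l (z k * z l) = -1)
  * (pair_op 0 k l (z k * z l * (z k - z l)) = z l - z k).
Proof.
rewrite !pair_opE // !fderiv_zz !fderiv_cubic fperm_zz fperm_cubic.
rewrite tpermL tpermR !eqxx (negPf kl) [l == k]eq_sym (negPf kl) !simp01.
by rewrite !mulrN1 pair_expr_zz ?pair_expr_cubic ?z_sub_neq0.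
Qed.

(** The product is linear in [z k], so its drift and exchange terms cancel; the cubic has leading
    coefficient [z l] in [z k], and the square of [z k] is sent to 1. *)
Lemma pair_op_half j : k != j -> l != j ->
  (pair_op 0 k j (z k * z l) = 0) * (pair_op 0 k j (z k * z l * (z k - z l)) = z l).
Proof.
move=> kj lj; have jl : j != l by rewrite eq_sym.
rewrite !pair_opE // !fderiv_zz !fderiv_cubic fperm_zz fperm_cubic.
rewrite tpermL (tpermD kl jl) eqxx (negPf kj) (negPf lj) [l == k]eq_sym (negPf kl) !simp01.
by rewrite pair_expr_zz1 ?pair_expr_cubic1 ?z_sub_neq0.
Qed.

Lemma pair_op_away i j : k != i -> l != i -> k != j -> l != j ->
  (pair_op 0 i j (z k * z l) = 0) * (pair_op 0 i j (z k * z l * (z k - z l)) = 0).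
Proof.
move=> ki li kj lj.
split; apply: pair_op_far => //; rewrite ?fderiv_zz ?fderiv_cubic.
- by rewrite (negPf ki) (negPf li) !simp01.
- by rewrite (negPf kj) (negPf lj) !simp01.
- by rewrite fperm_zz !tpermD 1?eq_sym.
- by rewrite (negPf ki) (negPf li) !simp01.
- by rewrite (negPf kj) (negPf lj) !simp01.
- by rewrite fperm_cubic !tpermD 1?eq_sym.
Qed.

End TwoIndices.

Lemma cubicC k l : z k * z l * (z k - z l) = - (z l * z k * (z l - z k)).
Proof. by rewrite -mulrN opprB [z l * z k]mulrC. Qed.

Lemma pair_opN eps i j x : (eps < 3)%N -> pair_op eps i j (- x) = - pair_op eps i j x.
Proof.
by move=> e3; rewrite !pair_opE // !raddfN /= pair_exprN.
Qed.

(** Exchanging [k] and [l] fixes the product and negates the cubic, and bonds are unoriented. Every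
    position of the bond thus reduces to three cases: both ends, one end or no end in {k, l}. *)
Lemma pair_op_two i j k l : i != j -> k != l ->
  (pair_op 0 i j (z k * z l) = - ((k == i)%:R * (l == j)%:R + (l == i)%:R * (k == j)%:R))
  * (pair_op 0 i j (z k * z l * (z k - z l)) =
    ((k == i)%:R + (k == j)%:R) * z l - ((l == i)%:R + (l == j)%:R) * z k).
Proof.
wlog lj : k l / l != j => [th|] ij kl.
  have /orP[/eqP lj|lj] := orbN (l == j); last exact: th.
  have lk : l != k by rewrite eq_sym.
  have kj : k != j by rewrite -lj.
  have [e1 e2] := th l k kj ij lk; split.
    by rewrite [z k * _]mulrC e1 addrC.
  by rewrite cubicC pair_opN // e2 opprB.
have lk : l != k by rewrite eq_sym.
wlog li : i j lj ij / l != i => [th|].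
  have /orP[/eqP li|li] := orbN (l == i); last exact: th.
  have /orP[/eqP kj|kj] := orbN (k == j).
    subst k l; rewrite cubicC [z j * z i]mulrC pair_opN // !pair_op_near //.
    by rewrite !eqxx (negPf kl) (negPf lj) !simp01 !opprB.
  subst l; rewrite cubicC [z k * z i]mulrC pair_opN // !(pair_op_half lk) //.
  by rewrite (negPf kl) (negPf kj) (negPf ij) eqxx !simp01.
rewrite (negPf lj) (negPf li) !simp01.
wlog kj : i j lj ij li / k != j => [th|].
  have /orP[/eqP kj|kj] := orbN (k == j); last exact: th.
  have ji : j != i by rewrite eq_sym.
  (* The last argument proves [k != i]: otherwise i = k = j. *)
  have [e1 e2] := th j i li ji lj (introN eqP (fun e => elimN eqP ij (etrans (esym e) kj))).
  by rewrite -!(pair_op_sym i j) // e1 e2 [(k == i)%:R + _]addrC.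
have /orP[/eqP ki|ki] := orbN (k == i).
  by subst k; rewrite !pair_op_half // eqxx (negPf ij) !simp01.
by rewrite !pair_op_away // (negPf ki) (negPf kj) !simp01.
Qed.

Lemma fderiv_zV i k : fderiv i (z k)^-1 = - (k == i)%:R / z k ^+ 2.
Proof. by rewrite fderivV ?z_neq0 // fderiv_z. Qed.

Lemma pair_op_inv i j k : i != j -> pair_op 2 i j (z k)^-1 = 0.
Proof.
have P s : fperm s (z k)^-1 = (z (s k))^-1.
  by rewrite -fperm_z; exact: fmorphV.
wlog kj : i j / k != j => [th|] ij.
  have /orP[/eqP kj|kj] := orbN (k == j); last exact: th.
  rewrite -(pair_op_sym i j) //; apply: th; rewrite 1?eq_sym //.
  by rewrite kj.
have /orP[/eqP ki|ki] := orbN (k == i).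
  subst k; rewrite pair_opE // !fderiv_zV P tpermL eqxx (negPf ij) !simp01.
  by rewrite pair_expr_inv ?z_neq0 ?z_sub_neq0.
apply: pair_op_far; rewrite // ?fderiv_zV ?P.
- by rewrite (negPf ki) !simp01.
- by rewrite (negPf kj) !simp01.
by rewrite tpermD // eq_sym.
Qed.

End Operator.

(** * Values of the operator on the short monomials *)

Section OperatorValues.
Variables (F : numFieldType) (N : nat).
Local Notation K := {fraction {mpoly F[N]}}.
Local Notation z := (@zF F N).
Local Notation nxt := (@ordS N).
Implicit Types (x y f : K) (i j k l : 'I_N).

Lemma Lap_sqr k : Lap 0 (z k ^+ 2) = 2.
Proof.
rewrite expr2 LapM !Lap_z !simp01 /Gam.
rewrite (eq_bigr (fun i => (k == i)%:R * (k == i)%:R)).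
  by rewrite (sum_delta k (fun i => (k == i)%:R)) eqxx !simp01.
by move=> i _; rewrite expr0 !fderiv_z mul1r.
Qed.

Lemma Lap_zz k l : k != l -> Lap 0 (z k * z l) = 0.
Proof.
move=> kl; rewrite LapM !Lap_z !simp01 /Gam.
rewrite (eq_bigr (fun i => (k == i)%:R * (l == i)%:R)).
  by rewrite (sum_delta k (fun i => (l == i)%:R)) eq_sym (negPf kl) !simp01.
by move=> i _; rewrite expr0 !fderiv_z mul1r.
Qed.

(** Follows from the product rule [LapM] applied to z_k^-1 z_k = 1, without differentiating the
    inverse twice. *)
Lemma Lap_inv k : Lap 2 (z k)^-1 = 2 / z k.
Proof.
have V := mulVf (z_neq0 F k).
have e : Lap 2 (z k)^-1 * z k + 2 * Gam 2 (z k)^-1 (z k) = 0.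
  have := LapM 2 (z k)^-1 (z k); rewrite V Lap_z mulr0 addr0 => <-.
  by apply: big1 => i _; rewrite fderiv1 fderiv0 mulr0.
have g : Gam 2 (z k)^-1 (z k) = -1.
  rewrite /Gam (eq_bigr (fun i => (k == i)%:R * ((z i / z k) ^+ 2 * - (k == i)%:R))).
    rewrite (sum_delta k (fun i => (z i / z k) ^+ 2 * - (k == i)%:R)).
    by rewrite divff ?z_neq0 // eqxx expr1n mul1r.
  move=> i _; rewrite fderiv_zV !fderiv_z expr_div_n.
  by move: (_ ^+ 2) (_ ^+ 2)^-1 => u v; ring.
apply: (mulIf (z_neq0 F k)); rewrite -mulrA V mulr1.
by apply/eqP; rewrite -subr_eq0; apply/eqP; rewrite -[RHS]e g; ring.
Qed.

Lemma Lap_cubic k l : k != l ->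
  Lap 0 (z k * z l * (z k - z l)) = 2 * (z l - z k).
Proof.
have e (i j : 'I_N) : i != j -> Lap 0 (z i * z j * z i) = 2 * z j.
  move=> ij; rewrite mulrAC -expr2 LapM Lap_sqr Lap_z mulr0 addr0 /Gam big1 ?mulr0 ?addr0 //.
  move=> h _; rewrite expr2 (fderivM h (z i)) !fderiv_z.
  have /orP[/eqP ih|ih] := orbN (i == h); last by rewrite (negPf ih) !simp01.
  by rewrite -ih [j == i]eq_sym (negPf ij) !simp01.
move=> kl; have lk : l != k by rewrite eq_sym.
by rewrite mulrBr (raddfB (Lap 0)) /= e // [z k * z l]mulrC e // mulrBr.
Qed.

Variable a : F.
Hypothesis N1 : (1 < N)%N.
Local Notation ac := (constF N a).

Lemma Tscalar_sqr k : Tscalar a 0 (z k ^+ 2) = 2 + 4 * ac.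
Proof.
rewrite TscalarE Lap_sqr /pair_sum.
rewrite (eq_bigr (fun i => ((k == i)%:R + (k == nxt i)%:R) * 1)).
  by rewrite sum_nbr; ring.
by move=> i _; rewrite mulr1; apply: pair_op_sqr; rewrite nxt_neq.
Qed.

Lemma Tscalar_zz k l : k != l ->
  Tscalar a 0 (z k * z l) = - 2 * ac * ((l == nxt k)%:R + (k == nxt l)%:R).
Proof.
move=> kl; rewrite TscalarE Lap_zz // add0r /pair_sum.
rewrite (eq_bigr (fun i => - ((k == i)%:R * (l == nxt i)%:R + (l == i)%:R * (k == nxt i)%:R))).
  rewrite sumrN big_split /= (sum_delta k (fun i => (l == nxt i)%:R)).
  by rewrite (sum_delta l (fun i => (k == nxt i)%:R)); ring.
by move=> i _; rewrite pair_op_two ?nxt_neq.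
Qed.

Lemma Tscalar_cubic k l : k != l ->
  Tscalar a 0 (z k * z l * (z k - z l)) = (2 + 4 * ac) * (z l - z k).
Proof.
move=> kl; rewrite TscalarE Lap_cubic // /pair_sum.
rewrite (eq_bigr (fun i => ((k == i)%:R + (k == nxt i)%:R) * z l
                            - ((l == i)%:R + (l == nxt i)%:R) * z k)).
  by rewrite sumrB !sum_nbr; ring.
by move=> i _; rewrite pair_op_two ?nxt_neq.
Qed.

Lemma Tscalar_inv k : Tscalar a 2 (z k)^-1 = 2 / z k.
Proof.
rewrite TscalarE Lap_inv /pair_sum big1 ?mulr0 ?addr0 // => i _.
by rewrite pair_op_inv ?nxt_neq.
Qed.

End OperatorValues.

(** Constants and variables generate the polynomial ring, so identities about composition need
    checking only on them. *)
Lemma mpoly_alg_ind (R : comNzRingType) (k : nat) (P : {mpoly R[k]} -> Prop) :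
  (forall c, P c%:MP) -> (forall i, P 'X_i) ->
  (forall p q, P p -> P q -> P (p + q)) ->
  (forall p q, P p -> P q -> P (p * q)) -> forall p, P p.
Proof.
move=> PC PX PD PM p; rewrite [p]mpolyE.
elim/big_ind: _ => [||m _]; [by rewrite -(mpolyC0 k) | exact: PD |].
rewrite -mul_mpolyC; apply: (PM) => //; rewrite mpolyXE_id.
elim/big_ind: _ => [||i _]; [by rewrite -(mpolyC1 k) | exact: PM |].
by elim: (m i) => [|e IH]; rewrite ?expr0 -?(mpolyC1 k) // exprS; apply: (PM).
Qed.

(** * The chain rule in symmetric generators *)

Section Chain.
Variables (R : comNzRingType) (n k : nat) (u : k.-tuple {mpoly R[n]}).

Lemma mderiv_comp i (f : {mpoly R[k]}) :
  (f \mPo u)^`M(i) = \sum_j (f^`M(j) \mPo u) * (tnth u j)^`M(i).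
Proof.
elim/mpoly_alg_ind: f => [c|j|p q IHp IHq|p q IHp IHq].
- rewrite comp_mpolyC mderivC big1 // => j _.
  by rewrite mderivC comp_mpoly0 mul0r.
- rewrite comp_mpolyXU -tnth_nth (bigD1 j) //= mderivXU eqxx comp_mpoly1 mul1r.
  rewrite big1 ?addr0 // => l lj.
  by rewrite mderivXU eq_sym (negPf lj) comp_mpoly0 mul0r.
- rewrite comp_mpolyD mderivD IHp IHq -big_split; apply: eq_bigr => j _ /=.
  by rewrite mderivD comp_mpolyD mulrDl.
rewrite rmorphM /= mderivM IHp IHq mulr_suml mulr_sumr -big_split.
apply: eq_bigr => j _ /=; rewrite mderivM comp_mpolyD !rmorphM /=.
by rewrite mulrDl mulrAC !mulrA.
Qed.

End Chain.

Section SymmetricComposition.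
Variables (F : numFieldType) (N k : nat) (u : k.-tuple {mpoly F[N]}).
Local Notation K := {fraction {mpoly F[N]}}.
Local Notation z := (@zF F N).
Local Notation nxt := (@ordS N).
Hypothesis usym : forall j s, msym s (tnth u j) = tnth u j.

Definition ev (f : {mpoly F[k]}) : K := (f \mPo u)%:F.
Local Notation U j := ((tnth u j)%:F : K).

Lemma ev_is_additive : zmod_morphism ev.
Proof. by move=> f g; rewrite /ev comp_mpolyB tofracB. Qed.

Lemma ev_is_multiplicative : monoid_morphism ev.
Proof. by split=> [|f g]; rewrite /ev ?comp_mpoly1 ?tofrac1 // rmorphM tofracM. Qed.

HB.instance Definition _ :=
  GRing.isZmodMorphism.Build {mpoly F[k]} K ev ev_is_additive.
HB.instance Definition _ :=
  GRing.isMonoidMorphism.Build {mpoly F[k]} K ev ev_is_multiplicative.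

Lemma evD f g : ev (f + g) = ev f + ev g.
Proof. exact: raddfD. Qed.

Lemma evM f g : ev (f * g) = ev f * ev g.
Proof. exact: rmorphM. Qed.

Lemma ev_sum (I : finType) (G : I -> {mpoly F[k]}) :
  ev (\sum_j G j) = \sum_j ev (G j).
Proof. exact: raddf_sum. Qed.

Lemma evX j : ev 'X_j = U j.
Proof. by rewrite /ev comp_mpolyXU -tnth_nth. Qed.

Lemma evC c : ev c%:MP = constF N c.
Proof. by rewrite /ev comp_mpolyC. Qed.

Lemma ev_sym f s : fperm s (ev f) = ev f.
Proof.
rewrite /ev fperm_tofrac; congr (_%:F).
elim/mpoly_alg_ind: f => [c|j|p q IHp IHq|p q IHp IHq].
- by rewrite comp_mpolyC -[c%:MP]mulr1 mul_mpolyC msymZ msym1.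
- by rewrite comp_mpolyXU -tnth_nth.
- by rewrite comp_mpolyD msymD IHp IHq.
by rewrite rmorphM msymM IHp IHq.
Qed.

Lemma fderiv_ev i f : fderiv i (ev f) = \sum_j ev f^`M(j) * fderiv i (U j).
Proof.
rewrite /ev fderiv_tofrac mderiv_comp raddf_sum; apply: eq_bigr => j _ /=.
by rewrite tofracM fderiv_tofrac.
Qed.

Lemma fderiv_sum (I : finType) i (G : I -> K) :
  fderiv i (\sum_j G j) = \sum_j fderiv i (G j).
Proof. exact: raddf_sum. Qed.

Lemma Lap_ev eps f : Lap eps (ev f) =
  \sum_j ev f^`M(j) * Lap eps (U j)
  + \sum_j \sum_l ev f^`M(j)^`M(l) * Gam eps (U j) (U l).
Proof.
rewrite -big_split /=.
under [RHS]eq_bigr => j _.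
  rewrite /Lap mulr_sumr.
  under [X in _ + X]eq_bigr => l _ do rewrite /Gam mulr_sumr.
  rewrite exchange_big -big_split /=.
  over.
rewrite exchange_big /Lap; apply: eq_bigr => i _ /=.
rewrite fderiv_ev fderiv_sum mulr_sumr; apply: eq_bigr => j _.
rewrite fderivM mulrDr addrC; congr (_ + _); last by rewrite mulrCA.
rewrite fderiv_ev.
rewrite mulr_suml mulr_sumr; apply: eq_bigr => l _.
by move: (ev _) (_ ^+ _) (fderiv _ _) (fderiv _ _) => *; ring.
Qed.

Lemma pair_sum_sym eps x : (forall s, fperm s x = x) -> pair_sum eps x =
  \sum_i (z i - z (nxt i))^-1 *
     (z i ^+ eps * fderiv i x - z (nxt i) ^+ eps * fderiv (nxt i) x).
Proof.
by move=> xs; apply: eq_bigr => i _; rewrite /pair_op xs subrr mulr0 subr0.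
Qed.

(** On symmetric functions the exchange term is zero, so the bond sum is first order and affects
    only the coefficients of first derivatives. *)
Lemma pair_sum_ev eps f : pair_sum eps (ev f) = \sum_j ev f^`M(j) * pair_sum eps (U j).
Proof.
rewrite pair_sum_sym => [|s]; last exact: ev_sym.
have us j s : fperm s (U j) = U j by rewrite fperm_tofrac usym.
under [RHS]eq_bigr => j _ do rewrite (pair_sum_sym _ (us j)) mulr_sumr.
rewrite exchange_big; apply: eq_bigr => i _ /=.
rewrite !fderiv_ev !mulr_sumr -sumrB mulr_sumr; apply: eq_bigr => j _.
by move: (ev _) (_ ^+ _) (_ ^+ _) (_^-1) (fderiv _ _) (fderiv _ _) => *; ring.
Qed.

Lemma Tscalar_ev a eps f : Tscalar a eps (ev f) =
  \sum_j ev f^`M(j) * Tscalar a eps (U j)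
  + \sum_j \sum_l ev f^`M(j)^`M(l) * Gam eps (U j) (U l).
Proof.
rewrite TscalarE Lap_ev pair_sum_ev addrAC; congr (_ + _).
rewrite mulr_sumr -big_split; apply: eq_bigr => j _ /=.
by rewrite TscalarE mulrDr; congr (_ + _); rewrite mulrCA.
Qed.

Definition Tpoly (alpha : 'I_k -> {mpoly F[k]}) (beta : 'I_k -> 'I_k -> {mpoly F[k]})
    (f : {mpoly F[k]}) : {mpoly F[k]} :=
  \sum_j f^`M(j) * alpha j + \sum_j \sum_l f^`M(j)^`M(l) * beta j l.

(** The disjunction asks for a correct [beta j l] only where the second derivative survives; the
    remaining pairings may fail to be polynomials in the generators. *)
Lemma Tscalar_ev_poly a eps alpha beta f :
  (forall j, Tscalar a eps (U j) = ev (alpha j)) ->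
  (forall j l, f^`M(j)^`M(l) = 0 \/ Gam eps (U j) (U l) = ev (beta j l)) ->
  Tscalar a eps (ev f) = ev (Tpoly alpha beta f).
Proof.
move=> ha hb; rewrite Tscalar_ev /Tpoly evD !ev_sum; congr (_ + _).
  by apply: eq_bigr => j _; rewrite ha evM.
apply: eq_bigr => j _; rewrite ev_sum; apply: eq_bigr => l _; rewrite evM.
case: (hb j l) => ->; last by [].
by rewrite (raddf0 ev) !mul0r.
Qed.

End SymmetricComposition.

(** * Weighted degrees *)

Section WeightedDegree.
Variables (R : comNzRingType) (k : nat).
Implicit Types (p q : {mpoly R[k]}) (w : 'I_k -> nat) (d e : int) (m : 'X_{1..k}).

Definition wdeg w m : nat := \sum_j w j * m j.

(* With [w = wunit i] this bounds the degree in the [i]-th variable alone. *)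
Definition wle w d p : Prop := forall m, m \in msupp p -> (wdeg w m)%:Z <= d.

Lemma wdegD w m1 m2 : wdeg w (m1 + m2)%MM = (wdeg w m1 + wdeg w m2)%N.
Proof. by rewrite -big_split; apply: eq_bigr => j _; rewrite mnmDE mulnDr. Qed.

Lemma wdeg0 w : wdeg w 0%MM = 0%N.
Proof. by apply: big1 => j _; rewrite mnm0E muln0. Qed.

Lemma wdegU w j : wdeg w U_(j)%MM = w j.
Proof.
rewrite /wdeg (bigD1 j) //= mnm1E eqxx muln1 big1 ?addn0 // => i.
by rewrite mnm1E eq_sym => /negPf->; rewrite muln0.
Qed.

Lemma wleW w d e p : d <= e -> wle w d p -> wle w e p.
Proof. by move=> de pd m /pd /le_trans; apply. Qed.

Lemma wle0 w d : wle w d 0.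
Proof. by move=> m; rewrite msupp0. Qed.

Lemma wleD w d p q : wle w d p -> wle w d q -> wle w d (p + q).
Proof.
by move=> pd qd m /msuppD_le; rewrite mem_cat => /orP[/pd|/qd].
Qed.

Lemma wleZ w d c p : wle w d p -> wle w d (c *: p).
Proof. by move=> pd m /msuppZ_le /pd. Qed.

Lemma wle_sum (I : Type) (r : seq I) (P : pred I) w d (G : I -> {mpoly R[k]}) :
  (forall i, P i -> wle w d (G i)) -> wle w d (\sum_(i <- r | P i) G i).
Proof. by move=> h; elim/big_ind: _ => //; [exact: wle0 | exact: wleD]. Qed.

Lemma wleM w d e p q : wle w d p -> wle w e q -> wle w (d + e) (p * q).
Proof.
move=> pd qe m /msuppM_le /allpairsP[[m1 m2] /= [/pd m1d /qe m2e ->]].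
by rewrite wdegD PoszD lerD.
Qed.

Lemma wleXm w m : wle w (wdeg w m)%:Z 'X_[m].
Proof. by move=> m'; rewrite msuppX inE => /eqP->. Qed.

Lemma wleX w j : wle w (w j)%:Z 'X_j.
Proof. by rewrite -wdegU; exact: wleXm. Qed.

Lemma wle1 w : wle w 0 1.
Proof. by rewrite -mpolyX0; have := @wleXm w 0%MM; rewrite wdeg0. Qed.

Lemma wleC w c : wle w 0 c%:MP.
Proof. by rewrite -[_%:MP]mulr1 mul_mpolyC; apply/wleZ/wle1. Qed.

Lemma wle_exp w (a n : nat) p : wle w a p -> wle w (a * n)%N (p ^+ n).
Proof.
move=> pa; elim: n => [|n IH]; first by rewrite muln0 expr0; exact: wle1.
by rewrite exprS mulnS PoszD; exact: wleM.
Qed.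

Lemma wle_deriv w d j p : wle w d p -> wle w (d - (w j)%:Z) p^`M(j).
Proof.
move=> pd m; rewrite mcoeff_msupp mcoeff_mderiv => nz.
have /pd : (m + U_(j))%MM \in msupp p.
  by rewrite mcoeff_msupp; apply: contraNneq nz => ->; rewrite mul0rn.
by rewrite wdegD wdegU PoszD lerBrDr.
Qed.

(** Bounds are integers and may be negative, which leaves no monomial. A vanishing derivative is
    read off a weight bound in this way. *)
Lemma wle_lt0 w d p : d < 0 -> wle w d p -> p = 0.
Proof.
move=> d0 pd; apply/mpolyP=> m; rewrite mcoeff0; apply/eqP; apply/negPn/negP.
by rewrite -mcoeff_msupp => /pd /le_lt_trans /(_ d0).
Qed.

End WeightedDegree.

(** Applied with the total degree to bound degrees in z, and with unit or zero weights to follow the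
    degree in a single variable through a change of arguments. *)
Lemma wle_comp (R : comNzRingType) (k l : nat) (w : 'I_k -> nat) (w' : 'I_l -> nat)
    (v : k.-tuple {mpoly R[l]}) d f :
  (forall j, wle w' (w j)%:Z (tnth v j)) -> wle w d f -> wle w' d (f \mPo v).
Proof.
move=> hv hf; rewrite comp_mpolyE big_seq; apply: wle_sum => m /hf md.
apply/wleZ/(wleW md); rewrite /wdeg.
elim/big_rec2: _ => [|j p n _ IH]; first exact: wle1.
by rewrite PoszD; apply: wleM IH; apply: wle_exp.
Qed.

Lemma comp_mpoly_comp (R : comNzRingType) (k l n : nat)
    (f : {mpoly R[k]}) (v : k.-tuple {mpoly R[l]}) (u : l.-tuple {mpoly R[n]}) :
  (f \mPo v) \mPo u = f \mPo [tuple (tnth v j) \mPo u | j < k].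
Proof.
elim/mpoly_alg_ind: f => [c|j|p q IHp IHq|p q IHp IHq].
- by rewrite !comp_mpolyC.
- by rewrite !comp_mpolyXU -!tnth_nth tnth_mktuple.
- by rewrite !comp_mpolyD IHp IHq.
by rewrite !rmorphM /= IHp IHq.
Qed.

(** A bound of 0 keeps variables of positive weight from occurring, so the values substituted for
    them do not matter. *)
Lemma eq_comp_wle0 (R : comNzRingType) (k n : nat) (w : 'I_k -> nat)
    (f : {mpoly R[k]}) (u v : k.-tuple {mpoly R[n]}) :
  wle w 0 f -> (forall j, w j = 0%N -> tnth u j = tnth v j) -> f \mPo u = f \mPo v.
Proof.
move=> f0 uv; rewrite !comp_mpolyE; apply: eq_big_seq => m /f0.
rewrite lez_nat leqn0 sum_nat_eq0 => /forallP m0; congr (_ *: _).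
apply: eq_bigr => j _; have := m0 j; rewrite muln_eq0 => /orP[/eqP/uv->//|/eqP->].
by rewrite !expr0.
Qed.

Definition wunit (k : nat) (i : 'I_k) : 'I_k -> nat := fun j => (j == i)%N.

Lemma wdeg_unit k (i : 'I_k) m : wdeg (wunit i) m = m i.
Proof.
rewrite /wdeg (bigD1 i) //= /wunit eqxx mul1n big1 ?addn0 // => j.
by move=> /negPf->; rewrite mul0n.
Qed.

(** In characteristic zero, two derivatives multiply the coefficient at exponent e by e(e-1), which
    is nonzero for e at least 2. *)
Lemma d2_eq0 (F : numFieldType) k (i : 'I_k) (f : {mpoly F[k]}) :
  d2 i f = 0 <-> wle (wunit i) 1 f.
Proof.
split=> [h m mf|h]; last first.
  apply: (@wle_lt0 _ _ (wunit i) (1 - (wunit i i)%:Z - (wunit i i)%:Z)).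
    by rewrite /wunit eqxx.
  by do 2!apply: wle_deriv.
rewrite wdeg_unit lez_nat leqNgt; apply/negP => mi.
move: mf; rewrite mcoeff_msupp => /negP; apply.
(* The coefficient at [m] reappears in the second derivative at this lower monomial; the truncated
   subtraction is exact because the exponent is at least 2. *)
have e : (m - (U_(i) + U_(i)) + (U_(i) + U_(i)))%MM = m.
  apply: submK; apply/mnm_lepP => j; rewrite mnmDE !mnm1E.
  by case: eqP => [<-|].
have := congr1 (mcoeff (m - (U_(i) + U_(i)))) h.
rewrite /d2 !mcoeff_mderiv mcoeff0 -addmA e -!mulrnA => /eqP.
by rewrite mulrn_eq0 => /orP[|//]; rewrite muln_eq0 //.
Qed.

(** * Formal weight against degree in z *)

Section Truncation.
Variables (F : fieldType) (k N : nat) (u : k.-tuple {mpoly F[N]}) (W : 'I_k -> nat).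
Hypothesis uhom : forall j, tnth u j \is (W j).-homog.

Lemma wdeg1 (n : nat) (m : 'X_{1..n}) : wdeg (fun=> 1%N) m = mdeg m.
Proof. by rewrite mdegE; apply: eq_bigr => j _; rewrite mul1n. Qed.

Lemma deg_leP (p : {mpoly F[N]}) d : deg_le p d <-> wle (fun=> 1%N) d p.
Proof.
split=> [pd m mp|pd p0].
  have p0 : p != 0 by apply: contraTneq mp => ->; rewrite msupp0.
  apply: le_trans (pd p0); rewrite wdeg1 lez_nat.
  by have := msize_mdeg_lt mp; case: (msize p).
have := mlead_supp p0 => /pd; rewrite wdeg1.
by rewrite -(mlead_deg p0).
Qed.

Lemma dhomog_comp m : 'X_[m] \mPo u \is (wdeg W m).-homog.
Proof.
rewrite comp_mpolyX /wdeg; elim/big_rec2: _ => [|j p n _ IH]; first exact: dhomog1.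
by apply: dhomogM => //; apply: dhomogMn.
Qed.

Lemma deg_le_comp f d : wle W d f -> deg_le (f \mPo u) d.
Proof.
move=> fd; apply/deg_leP; apply: wle_comp fd => j m /(dhomog_mf (uhom j)) <-.
by rewrite wdeg1.
Qed.

(* Monomials of distinct weights contribute to distinct homogeneous components,
   so no algebraic independence of the [tnth u j] is needed. *)
Lemma truncation f d : deg_le (f \mPo u) d -> exists g,
  [/\ g \mPo u = f \mPo u, wle W d g & {subset msupp g <= msupp f}].
Proof.
move=> /deg_leP fd.
pose part (P : pred 'X_{1..k}) := \sum_(m <- msupp f | P m) f@_m *: 'X_[m].
have partE P mu : (part P)@_mu = if P mu then f@_mu else 0.
  rewrite /part raddf_sum /= -big_filter.
  under eq_bigr do rewrite mcoeffZ mcoeffX.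
  have [muf|muf] := boolP (mu \in [seq m <- msupp f | P m]).
    rewrite (bigD1_seq mu) ?filter_uniq ?msupp_uniq //= eqxx mulr1 big1 ?addr0.
      by move: muf; rewrite mem_filter => /andP[->].
    by move=> m /negPf->; rewrite mulr0.
  rewrite big1_seq => [|m /= mf]; last first.
    by case: eqP => [e|]; rewrite ?mulr0 //; rewrite -e mf in muf.
  case: ifP => // Pmu; apply/esym/eqP; rewrite -[_ == _]negbK -mcoeff_msupp.
  by move: muf; rewrite mem_filter Pmu.
pose low m := (wdeg W m)%:Z <= d.
have fE : f = part low + part (predC low).
  by rewrite [LHS]mpolyE /part (bigID low).
have coef P mu : (part P \mPo u)@_mu =
    \sum_(m <- msupp f | P m && (wdeg W m == mdeg mu)) f@_m * ('X_[m] \mPo u)@_mu.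
  rewrite /part (raddf_sum (comp_mpoly u)) /= (raddf_sum (mcoeff mu)) /=.
  rewrite [LHS](bigID (fun m => wdeg W m == mdeg mu)) /=.
  rewrite [X in _ + X]big1 ?addr0 => [|m /andP[_ ne]].
    by apply: eq_bigr => m _; rewrite comp_mpolyZ mcoeffZ.
  by rewrite comp_mpolyZ mcoeffZ (dhomog_nemf_coeff (dhomog_comp m)) ?mulr0 // eq_sym.
(* In degrees up to d no discarded monomial contributes. Above d the kept part contributes nothing,
   so the coefficient is that of [f \mPo u], zero by the degree bound. *)
have high0 : part (predC low) \mPo u = 0.
  apply/mpolyP => mu; rewrite mcoeff0; have [mud|mud] := boolP ((mdeg mu)%:Z <= d).
    rewrite coef big1 // => m /andP[/= /negP nl /eqP e]; exfalso.
    by apply: nl; rewrite /low e.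
  have -> : part (predC low) \mPo u = (f \mPo u) - (part low \mPo u).
    by rewrite {1}fE comp_mpolyD addrAC subrr add0r.
  rewrite mcoeffB coef [X in _ - X]big1 ?subr0 => [|m /andP[lm /eqP e]]; last first.
    by case/negP: mud; rewrite -e.
  apply/eqP; apply: contraNT mud; rewrite -mcoeff_msupp => /fd.
  by rewrite wdeg1.
exists (part low); split=> [|m|m].
- by rewrite [in RHS]fE comp_mpolyD high0 addr0.
- by rewrite mcoeff_msupp partE; case: ifP => //; rewrite eqxx.
by rewrite !mcoeff_msupp partE; case: ifP => //; rewrite eqxx.
Qed.

End Truncation.

Local Notation o0 := (@Ordinal 3 0 isT).
Local Notation o1 := (@Ordinal 3 1 isT).
Local Notation o2 := (@Ordinal 3 2 isT).

Lemma I3_ind (P : 'I_3 -> Prop) : P o0 -> P o1 -> P o2 -> forall j, P j.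
Proof.
move=> P0 P1 P2 [[|[|[|//]]] h].
- by rewrite (_ : Ordinal h = o0) //; apply: val_inj.
- by rewrite (_ : Ordinal h = o1) //; apply: val_inj.
by rewrite (_ : Ordinal h = o2) //; apply: val_inj.
Qed.

(** * Power sums and elementary symmetric polynomials *)

Section PowerSums.
Variables (F : numFieldType) (N : nat).
Local Notation K := {fraction {mpoly F[N]}}.
Local Notation z := (@zF F N).
Local Notation nxt := (@ordS N).
Local Notation sg := (sigma F N).
Local Notation ta := (tau F N).
Local Notation S k := ((sg k)%:F : K).
Local Notation P := ((ta N)%:F : K).
Local Notation Q := ((ta N.-1)%:F : K).

Lemma sigma_homog k : sg k \is k.-homog.
Proof.
apply: rpred_sum => i _.
have h : ('X_i : {mpoly F[N]}) \is 1.-homog by rewrite dhomogX /= mdeg1.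
by have := dhomogMn k h; rewrite mul1n.
Qed.

Lemma sigma_sym k s : msym s (sg k) = sg k.
Proof.
rewrite /sigma raddf_sum /= (reindex_inj (@perm_inj _ s^-1)).
apply: eq_bigr => i _; rewrite rmorphXn /= msymX; congr (_ ^+ _); congr (mpolyX _ _).
apply/mnmP=> j; rewrite mnmE !mnm1E; congr nat_of_bool.
by rewrite (inj_eq (@perm_inj _ s^-1)).
Qed.

Lemma tau_sym k s : msym s (ta k) = ta k.
Proof. by apply: (issymP _ _); exact: mesym_sym. Qed.

Lemma sigmaE k : S k = \sum_i z i ^+ k.
Proof.
rewrite /sigma (raddf_sum (@FracField.tofrac _)); apply: eq_bigr => i _.
exact: tofracXn.
Qed.

Lemma tauNE : P = \prod_i z i.
Proof.
by rewrite /tau mesymnnE (rmorph_prod (@FracField.tofrac _)).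
Qed.

(** The sets of N-1 indices are the complements of points, so the monomials of tau_(N-1) are the
    quotients tau_N / z_i. *)
Lemma tauN1E : (0 < N)%N -> Q = P * \sum_i (z i)^-1.
Proof.
move=> N0; rewrite tauNE mulr_sumr /tau /mesym -big_set /=.
have -> : [set h : {set 'I_N} | #|h| == N.-1] = [set [set~ i] | i : 'I_N].
  apply/setP => h; rewrite inE; apply/idP/imsetP => [hN|[i _ ->]]; last first.
    by rewrite cardsC1 card_ord.
  have /cards1P[i e] : #|~: h| == 1%N.
    by have := cardsC h; rewrite card_ord (eqP hN) => ?; apply/eqP; lia.
  by exists i; rewrite // -e setCK.
rewrite big_imset /= => [|i j _ _ /setC_inj/set1_inj//].
rewrite (raddf_sum (@FracField.tofrac _)); apply: eq_bigr => i _ /=.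
rewrite (rmorph_prod (@FracField.tofrac _)) [in RHS](bigD1 i) //=.
rewrite mulrC mulKf ?z_neq0 //.
by apply: eq_bigl => j; rewrite !inE.
Qed.

Lemma fderiv_sigma k i : fderiv i (S k.+1) = k.+1%:R * z i ^+ k.
Proof.
have D j n : fderiv i (z j ^+ n) = n%:R * z j ^+ n.-1 * (j == i)%:R.
  elim: n => [|n IH]; first by rewrite expr0 fderiv1 !mul0r.
  rewrite exprS fderivM IH fderiv_z /=.
  case: n {IH} => [|n] /=; first by rewrite !expr0; ring.
  by rewrite !exprS; ring.
rewrite sigmaE fderiv_sum (eq_bigr (fun j => (i == j)%:R * (k.+1%:R * z j ^+ k))).
  by rewrite (sum_delta i (fun j => k.+1%:R * z j ^+ k)).
by move=> j _; rewrite D /= eq_sym mulrC.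
Qed.

Lemma fderiv_tauN i : fderiv i P = P / z i.
Proof.
have m1 : (\sum_(j < N) U_(j))%MM i = 1%N.
  rewrite mnm_sumE (bigD1 i) //= mnm1E eqxx big1 // => j.
  by rewrite mnm1E => /negPf->.
apply: (canRL (mulfK (z_neq0 F i))); rewrite fderiv_tofrac /zF -tofracM.
rewrite /tau mesymnnE mprodXE mderivX m1 scale1r -mpolyXD submK //.
by apply/mnm_lepP => j; rewrite mnm1E; case: eqP => // <-; rewrite m1.
Qed.

Lemma fderiv_tauN1 i : (0 < N)%N -> fderiv i Q = (Q - P / z i) / z i.
Proof.
move=> N0; have e : \sum_j fderiv i (z j)^-1 = - (z i)^-1 ^+ 2.
  rewrite (eq_bigr (fun j => (i == j)%:R * - (z j)^-1 ^+ 2)) => [|j _].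
    by rewrite (sum_delta i (fun j => - (z j)^-1 ^+ 2)).
  by rewrite fderiv_zV eq_sym mulNr mulrN exprVn.
rewrite tauN1E // fderivM fderiv_tauN fderiv_sum e.
by move: (z i)^-1 (\sum_j _) P => *; ring.
Qed.

(** On a bond the divided difference of c0 + c1 z + c2 z^2 is c1 + c2 (z_i + z_(i+1)), with no pole;
    every generator has such a gradient, with coefficients independent of i. *)
Lemma pair_sum_quadratic eps (x c0 c1 c2 : K) : (1 < N)%N ->
  (forall s, fperm s x = x) ->
  (forall i, z i ^+ eps * fderiv i x = c0 + c1 * z i + c2 * z i ^+ 2) ->
  pair_sum eps x = N%:R * c1 + 2 * c2 * S 1.
Proof.
move=> N1 xs xq; rewrite pair_sum_sym //.
rewrite (eq_bigr (fun i => c1 + c2 * (z i + z (nxt i)))) => [|i _].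
  rewrite big_split /= sumr_const card_ord -mulr_natl -mulr_sumr big_split /=.
  rewrite (sum_nxt (fun i => z i)) sigmaE.
  by under [in RHS]eq_bigr do rewrite expr1; move: (\sum_i _) => *; ring.
rewrite !xq; have d0 := z_sub_neq0 F (nxt_neq i N1).
apply: (mulfI d0); rewrite mulVKf //.
move: (z i) (z (nxt i)) => *; ring.
Qed.

Section Values.
Variable a : F.
Hypothesis N1 : (1 < N)%N.
Local Notation ac := (constF N a).

Let ssym k s : fperm s (S k) = S k.
Proof. by rewrite fperm_tofrac sigma_sym. Qed.

Let tsym k s : fperm s ((ta k)%:F) = (ta k)%:F :> K.
Proof. by rewrite fperm_tofrac tau_sym. Qed.

Lemma fderiv_sigma1 i : fderiv i (S 1) = 1.
Proof. by rewrite fderiv_sigma expr0 mulr1. Qed.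

Lemma fderiv_sigma2 i : fderiv i (S 2) = 2 * z i.
Proof. by rewrite fderiv_sigma expr1. Qed.

Lemma fderiv_sigma3 i : fderiv i (S 3) = 3 * z i ^+ 2.
Proof. by rewrite fderiv_sigma. Qed.

Lemma fderiv_natl i n (x : K) : fderiv i (n%:R * x) = n%:R * fderiv i x.
Proof. by rewrite fderivM fderiv_nat mul0r add0r. Qed.

Lemma Lap_sigma1 eps : Lap eps (S 1) = 0.
Proof. by apply: big1 => i _; rewrite fderiv_sigma1 fderiv1 mulr0. Qed.

Lemma Lap_sigma2 eps : Lap eps (S 2) = 2 * S eps.
Proof.
rewrite (sigmaE eps) mulr_sumr; apply: eq_bigr => i _.
by rewrite fderiv_sigma2 fderiv_natl fderiv_z eqxx mulr1 mulrC.
Qed.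

Lemma Lap_sigma3 eps : Lap eps (S 3) = 6 * S eps.+1.
Proof.
rewrite (sigmaE eps.+1) mulr_sumr; apply: eq_bigr => i _.
rewrite fderiv_sigma3 fderiv_natl expr2 fderivM fderiv_z eqxx exprS mul1r mulr1.
by move: (z i ^+ eps) => *; ring.
Qed.

(** tau_N, and likewise tau_(N-1) below, is affine in each variable, so its pure second derivatives
    vanish. *)
Lemma Lap_tauN eps : Lap eps P = 0.
Proof.
apply: big1 => i _; rewrite fderiv_tauN fderivM fderiv_tauN fderiv_zV eqxx mulr1n -exprVn.
by move: (z i)^-1 P => *; ring.
Qed.

Lemma Lap_tauN1 eps : Lap eps Q = 0.
Proof.
apply: big1 => i _; rewrite fderiv_tauN1 1?ltnW // fderivM fderivB fderivM.
rewrite fderiv_tauN1 1?ltnW // fderiv_tauN !fderiv_zV eqxx mulr1n -!exprVn.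
by move: (z i)^-1 P Q => *; ring.
Qed.

Lemma Tscalar_sym eps (x c0 c1 c2 : K) :
  (forall s, fperm s x = x) ->
  (forall i, z i ^+ eps * fderiv i x = c0 + c1 * z i + c2 * z i ^+ 2) ->
  Tscalar a eps x = Lap eps x + 2 * ac * (N%:R * c1 + 2 * c2 * S 1).
Proof. by move=> xs xq; rewrite TscalarE (pair_sum_quadratic N1 xs xq). Qed.

Lemma sigma0 : S 0 = N%:R.
Proof.
by rewrite sigmaE (eq_bigr (fun=> 1)) // sumr_const card_ord.
Qed.

Lemma Tscalar0_sigma1 : Tscalar a 0 (S 1) = 0.
Proof.
rewrite (@Tscalar_sym 0 _ 1 0 0) ?Lap_sigma1 //; first by ring.
by move=> i; rewrite fderiv_sigma1; ring.
Qed.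

Lemma Tscalar0_sigma2 : Tscalar a 0 (S 2) = (2 + 4 * ac) * N%:R.
Proof.
rewrite (@Tscalar_sym 0 _ 0 2 0) ?Lap_sigma2 ?sigma0 //; first by ring.
by move=> i; rewrite fderiv_sigma2; ring.
Qed.

Lemma Tscalar0_sigma3 : Tscalar a 0 (S 3) = (6 + 12 * ac) * S 1.
Proof.
rewrite (@Tscalar_sym 0 _ 0 0 3) ?Lap_sigma3 //; first by ring.
by move=> i; rewrite fderiv_sigma3; ring.
Qed.

Lemma Tscalar1_sigma1 : Tscalar a 1 (S 1) = 2 * ac * N%:R.
Proof.
rewrite (@Tscalar_sym 1 _ 0 1 0) ?Lap_sigma1 //; first by ring.
by move=> i; rewrite fderiv_sigma1; ring.
Qed.

Lemma Tscalar1_sigma2 : Tscalar a 1 (S 2) = (2 + 8 * ac) * S 1.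
Proof.
rewrite (@Tscalar_sym 1 _ 0 0 2) ?Lap_sigma2 //; first by ring.
by move=> i; rewrite fderiv_sigma2; ring.
Qed.

Lemma Tscalar1_tauN : Tscalar a 1 P = 0.
Proof.
rewrite (@Tscalar_sym 1 _ P 0 0) ?Lap_tauN //; first by ring.
move=> i; rewrite fderiv_tauN expr1 mulrC divfK ?z_neq0 //.
by move: P => *; ring.
Qed.

Lemma Tscalar2_sigma1 : Tscalar a 2 (S 1) = 4 * ac * S 1.
Proof.
rewrite (@Tscalar_sym 2 _ 0 0 1) ?Lap_sigma1 //; first by ring.
by move=> i; rewrite fderiv_sigma1; ring.
Qed.

Lemma z2_fderiv_tauN1 i : z i ^+ 2 * fderiv i Q = z i * Q - P.
Proof.
have V := divff (z_neq0 F i).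
rewrite fderiv_tauN1 1?ltnW // expr2 -!mulrA [z i * (_ / _)]mulrCA V mulr1.
by rewrite mulrBr mulrCA V mulr1.
Qed.

Lemma z2_fderiv_tauN i : z i ^+ 2 * fderiv i P = P * z i.
Proof. by rewrite fderiv_tauN expr2 -mulrA mulrC mulrCA divff ?z_neq0 ?mulr1. Qed.

Lemma Tscalar2_tauN1 : Tscalar a 2 Q = 2 * ac * N%:R * Q.
Proof.
rewrite (@Tscalar_sym 2 _ (- P) Q 0) ?Lap_tauN1 //; first by ring.
by move=> i; rewrite z2_fderiv_tauN1; ring.
Qed.

Lemma Tscalar2_tauN : Tscalar a 2 P = 2 * ac * N%:R * P.
Proof.
rewrite (@Tscalar_sym 2 _ 0 P 0) ?Lap_tauN //; first by ring.
by move=> i; rewrite z2_fderiv_tauN; ring.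
Qed.
End Values.
End PowerSums.

(** * Gradient pairings of the symmetric generators *)

Section GamTables.
Variables (F : numFieldType) (N : nat).
Local Notation K := {fraction {mpoly F[N]}}.
Local Notation z := (@zF F N).
Local Notation sg := (sigma F N).
Local Notation ta := (tau F N).
Local Notation S k := ((sg k)%:F : K).
Local Notation P := ((ta N)%:F : K).
Local Notation Q := ((ta N.-1)%:F : K).
Implicit Types (x y : K).

Lemma GamC eps x y : Gam eps x y = Gam eps y x.
Proof. by apply: eq_bigr => i _; rewrite mulrAC. Qed.

Lemma GamM eps x y1 y2 : Gam eps x (y1 * y2) = y1 * Gam eps x y2 + Gam eps x y1 * y2.
Proof.
rewrite /Gam mulr_sumr mulr_suml -big_split; apply: eq_bigr => i _ /=.
rewrite fderivM; move: (fderiv i x) (_ ^+ _) (fderiv i _) (fderiv i _) => *; ring.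
Qed.

Lemma GamB eps x y1 y2 : Gam eps x (y1 - y2) = Gam eps x y1 - Gam eps x y2.
Proof. by rewrite /Gam -sumrB; apply: eq_bigr => i _; rewrite fderivB mulrBr. Qed.

Lemma Gam_z eps x k : Gam eps x (z k) = z k ^+ eps * fderiv k x.
Proof.
rewrite /Gam (eq_bigr (fun i => (k == i)%:R * (z i ^+ eps * fderiv i x))).
  by rewrite (sum_delta k (fun i => z i ^+ eps * fderiv i x)).
by move=> i _; rewrite fderiv_z mulrC.
Qed.

Lemma Gam_zV eps x k : Gam eps x (z k)^-1 = - Gam eps x (z k) / z k ^+ 2.
Proof.
rewrite Gam_z /Gam (eq_bigr (fun i => (k == i)%:R * - (z i ^+ eps * fderiv i x / z k ^+ 2))).
  rewrite (sum_delta k (fun i => - (z i ^+ eps * fderiv i x / z k ^+ 2))).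
  by rewrite mulNr.
by move=> i _; rewrite fderiv_zV; move: (k == i)%:R (z k ^- 2) => *; ring.
Qed.

(** Each pairing sums a Laurent polynomial in z_i with coefficients independent of i. The 1/z_i term
    serves [Gam2_QN], where tau_N sum_i 1/z_i folds back into tau_(N-1). *)
Lemma Gam_expand eps x y (c0 c1 c2 c3 d : K) :
  (forall i, z i ^+ eps * fderiv i x * fderiv i y =
     c0 + c1 * z i + c2 * z i ^+ 2 + c3 * z i ^+ 3 + d * (z i)^-1) ->
  Gam eps x y =
    N%:R * c0 + c1 * S 1 + c2 * S 2 + c3 * S 3 + d * \sum_i (z i)^-1.
Proof.
move=> e; transitivity (\sum_i (c0 + c1 * z i + c2 * z i ^+ 2 + c3 * z i ^+ 3
    + d * (z i)^-1)); first by apply: eq_bigr => i _; exact: e.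
rewrite !big_split /= sumr_const card_ord mulr_natl -!mulr_sumr.
have -> : S 1 = \sum_i z i by rewrite sigmaE; under eq_bigr do rewrite expr1.
by rewrite (sigmaE F N 2) (sigmaE F N 3).
Qed.

Hypothesis N1 : (1 < N)%N.
Let N0 : (0 < N)%N := ltnW N1.

Lemma Gam0_11 : Gam 0 (S 1) (S 1) = N%:R.
Proof.
rewrite (@Gam_expand _ _ _ 1 0 0 0 0); first by ring.
by move=> i; rewrite !fderiv_sigma1; ring.
Qed.

Lemma Gam0_12 : Gam 0 (S 1) (S 2) = 2 * S 1.
Proof.
rewrite (@Gam_expand _ _ _ 0 2 0 0 0); first by ring.
by move=> i; rewrite fderiv_sigma1 fderiv_sigma2; ring.
Qed.

Lemma Gam0_13 : Gam 0 (S 1) (S 3) = 3 * S 2.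
Proof.
rewrite (@Gam_expand _ _ _ 0 0 3 0 0); first by ring.
by move=> i; rewrite fderiv_sigma1 fderiv_sigma3; ring.
Qed.

Lemma Gam0_22 : Gam 0 (S 2) (S 2) = 4 * S 2.
Proof.
rewrite (@Gam_expand _ _ _ 0 0 4 0 0); first by ring.
by move=> i; rewrite !fderiv_sigma2; ring.
Qed.

Lemma Gam0_23 : Gam 0 (S 2) (S 3) = 6 * S 3.
Proof.
rewrite (@Gam_expand _ _ _ 0 0 0 6 0); first by ring.
by move=> i; rewrite fderiv_sigma2 fderiv_sigma3; ring.
Qed.

Lemma Gam1_11 : Gam 1 (S 1) (S 1) = S 1.
Proof.
rewrite (@Gam_expand _ _ _ 0 1 0 0 0); first by ring.
by move=> i; rewrite !fderiv_sigma1; ring.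
Qed.

Lemma Gam1_12 : Gam 1 (S 1) (S 2) = 2 * S 2.
Proof.
rewrite (@Gam_expand _ _ _ 0 0 2 0 0); first by ring.
by move=> i; rewrite fderiv_sigma1 fderiv_sigma2; ring.
Qed.

Lemma z_fderiv_tauN i : z i * fderiv i P = P.
Proof. by rewrite fderiv_tauN mulrC divfK ?z_neq0. Qed.

Lemma Gam1_1N : Gam 1 (S 1) P = N%:R * P.
Proof.
rewrite (@Gam_expand _ _ _ P 0 0 0 0); first by ring.
by move=> i; rewrite fderiv_sigma1 expr1 mulr1 z_fderiv_tauN; ring.
Qed.

Lemma Gam1_2N : Gam 1 (S 2) P = 2 * (S 1 * P).
Proof.
rewrite (@Gam_expand _ _ _ 0 (2 * P) 0 0 0); first by ring.
by move=> i; rewrite fderiv_sigma2 expr1 mulrAC z_fderiv_tauN; ring.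
Qed.

Lemma Gam2_1Q : Gam 2 (S 1) Q = S 1 * Q - N%:R * P.
Proof.
rewrite (@Gam_expand _ _ _ (- P) Q 0 0 0); first by ring.
by move=> i; rewrite fderiv_sigma1 mulr1 z2_fderiv_tauN1 //; ring.
Qed.

Lemma Gam2_1N : Gam 2 (S 1) P = S 1 * P.
Proof.
rewrite (@Gam_expand _ _ _ 0 P 0 0 0); first by ring.
by move=> i; rewrite fderiv_sigma1 mulr1 z2_fderiv_tauN; ring.
Qed.

Lemma Gam2_NN : Gam 2 P P = N%:R * (P * P).
Proof.
rewrite (@Gam_expand _ _ _ (P * P) 0 0 0 0); first by ring.
move=> i; rewrite expr2 -mulrA mulrACA mulrA z_fderiv_tauN.
by rewrite -mulrA z_fderiv_tauN; ring.
Qed.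

Lemma Gam2_QN : Gam 2 Q P = (N%:R - 1) * (Q * P).
Proof.
rewrite (@Gam_expand _ _ _ (Q * P) 0 0 0 (- P * P)).
  by rewrite -mulrA mulNr -tauN1E //; ring.
move=> i; rewrite z2_fderiv_tauN1 // fderiv_tauN.
transitivity (z i / z i * (Q * P) - P * P / z i); last first.
  by rewrite divff ?z_neq0 //; move: (z i)^-1 P Q => *; ring.
by move: (z i)^-1 P Q => *; ring.
Qed.

End GamTables.

(** * The operator on polynomials in three generators *)

Section Tables.
Variables (F : numFieldType) (N : nat) (a : F).
Hypothesis N2 : (2 < N)%N.
Local Notation K := {fraction {mpoly F[N]}}.
Local Notation z := (@zF F N).
Local Notation sg := (sigma F N).
Local Notation ta := (tau F N).
Local Notation S k := ((sg k)%:F : K).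
Local Notation P := ((ta N)%:F : K).
Local Notation Q := ((ta N.-1)%:F : K).
Local Notation "''x_' j" := ('X_j : {mpoly F[3]}) (at level 8, j at level 2).
Let N1 : (1 < N)%N := ltnW N2.

Definition u0 : 3.-tuple {mpoly F[N]} := [tuple sg 1; sg 2; sg 3].
Definition u1 : 3.-tuple {mpoly F[N]} := [tuple sg 1; sg 2; ta N].
Definition u2 : 3.-tuple {mpoly F[N]} := [tuple sg 1; ta N.-1; ta N].

Definition W0 (j : 'I_3) : nat := nth 0%N [:: 1; 2; 3]%N j.
Definition W1 (j : 'I_3) : nat := nth 0%N [:: 1; 2; N]%N j.
Definition W2 (j : 'I_3) : nat := nth 0%N [:: 1; N.-1; N]%N j.

Lemma u0_hom j : tnth u0 j \is (W0 j).-homog.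
Proof. by elim/I3_ind: j; apply: sigma_homog. Qed.

Lemma u1_hom j : tnth u1 j \is (W1 j).-homog.
Proof. by elim/I3_ind: j; [exact: sigma_homog | exact: sigma_homog | exact: dhomog_mesym]. Qed.

Lemma u2_hom j : tnth u2 j \is (W2 j).-homog.
Proof.
by elim/I3_ind: j; [exact: sigma_homog | exact: dhomog_mesym | exact: dhomog_mesym].
Qed.

Lemma u0_sym j s : msym s (tnth u0 j) = tnth u0 j.
Proof. by elim/I3_ind: j; apply: sigma_sym. Qed.

Lemma u1_sym j s : msym s (tnth u1 j) = tnth u1 j.
Proof. by elim/I3_ind: j; [exact: sigma_sym | exact: sigma_sym | exact: tau_sym]. Qed.

Lemma u2_sym j s : msym s (tnth u2 j) = tnth u2 j.
Proof. by elim/I3_ind: j; [exact: sigma_sym | exact: tau_sym | exact: tau_sym]. Qed.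

(* [alpha j] is [T u_j] and [beta j l] is [Gam u_j u_l], written in the
   generators; the zero diagonal entries of [beta] are junk, used only when the
   corresponding second derivative vanishes. *)
Definition alpha0 (j : 'I_3) : {mpoly F[3]} := nth 0
  [:: 0%:MP; ((2 + 4 * a) * N%:R)%:MP; (6 + 12 * a)%:MP * 'x_o0] j.

Definition beta0 (j l : 'I_3) : {mpoly F[3]} := nth 0 (nth [::] [::
  [:: N%:R%:MP; 2%:MP * 'x_o0; 3%:MP * 'x_o1];
  [:: 2%:MP * 'x_o0; 4%:MP * 'x_o1; 6%:MP * 'x_o2];
  [:: 3%:MP * 'x_o1; 6%:MP * 'x_o2; 0]] j) l.

Definition alpha1 (j : 'I_3) : {mpoly F[3]} := nth 0
  [:: (2 * a * N%:R)%:MP; (2 + 8 * a)%:MP * 'x_o0; 0%:MP] j.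

Definition beta1 (j l : 'I_3) : {mpoly F[3]} := nth 0 (nth [::] [::
  [:: 1%:MP * 'x_o0; 2%:MP * 'x_o1; N%:R%:MP * 'x_o2];
  [:: 2%:MP * 'x_o1; 0; 2%:MP * ('x_o0 * 'x_o2)];
  [:: N%:R%:MP * 'x_o2; 2%:MP * ('x_o0 * 'x_o2); 0]] j) l.

Definition alpha2 (j : 'I_3) : {mpoly F[3]} := nth 0
  [:: (4 * a)%:MP * 'x_o0; (2 * a * N%:R)%:MP * 'x_o1; (2 * a * N%:R)%:MP * 'x_o2] j.

Definition beta2 (j l : 'I_3) : {mpoly F[3]} := nth 0 (nth [::] [::
  [:: 0; 1%:MP * ('x_o0 * 'x_o1) + (- N%:R)%:MP * 'x_o2; 1%:MP * ('x_o0 * 'x_o2)];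
  [:: 1%:MP * ('x_o0 * 'x_o1) + (- N%:R)%:MP * 'x_o2; 0; (N%:R - 1)%:MP * ('x_o1 * 'x_o2)];
  [:: 1%:MP * ('x_o0 * 'x_o2); (N%:R - 1)%:MP * ('x_o1 * 'x_o2);
      N%:R%:MP * ('x_o2 * 'x_o2)]] j) l.

Definition constE := (rmorphD (@constF F N), rmorphM (@constF F N), rmorphN (@constF F N),
  rmorphB (@constF F N), rmorph_nat (@constF F N), rmorph1 (@constF F N),
  rmorph0 (@constF F N)).

Lemma Tscalar_ev0 f : d2 o2 f = 0 ->
  Tscalar a 0 (ev u0 f) = ev u0 (Tpoly alpha0 beta0 f).
Proof.
move=> f22; apply: Tscalar_ev_poly; first exact: u0_sym.
  elim/I3_ind; rewrite /alpha0 /= ?(evM, evX, evC) ?constE.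
  - by rewrite Tscalar0_sigma1.
  - by rewrite Tscalar0_sigma2.
  - by rewrite Tscalar0_sigma3.
(* [left] closes the diagonal entry of sigma_3, whose second derivative vanishes by [f22]. *)
elim/I3_ind; elim/I3_ind; rewrite /beta0 /=; try (by left); right;
  rewrite ?(evM, evX, evC) ?constE.
- exact: Gam0_11.
- exact: Gam0_12.
- exact: Gam0_13.
- by rewrite GamC; exact: Gam0_12.
- exact: Gam0_22.
- exact: Gam0_23.
- by rewrite GamC; exact: Gam0_13.
- by rewrite GamC; exact: Gam0_23.
Qed.

Lemma Tscalar_ev1 f : d2 o1 f = 0 -> d2 o2 f = 0 ->
  Tscalar a 1 (ev u1 f) = ev u1 (Tpoly alpha1 beta1 f).
Proof.
move=> f11 f22; apply: Tscalar_ev_poly; first exact: u1_sym.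
  elim/I3_ind; rewrite /alpha1 /= ?(evM, evX, evC) ?constE.
  - by rewrite Tscalar1_sigma1.
  - by rewrite Tscalar1_sigma2.
  - by rewrite Tscalar1_tauN.
elim/I3_ind; elim/I3_ind; rewrite /beta1 /=; try (by left); right;
  rewrite ?(evM, evX, evC) ?constE ?mul1r.
- exact: Gam1_11.
- exact: Gam1_12.
- exact: Gam1_1N.
- by rewrite GamC; exact: Gam1_12.
- exact: Gam1_2N.
- by rewrite GamC; exact: Gam1_1N.
- by rewrite GamC; exact: Gam1_2N.
Qed.

Lemma Tscalar_ev2 f : d2 o0 f = 0 -> d2 o1 f = 0 ->
  Tscalar a 2 (ev u2 f) = ev u2 (Tpoly alpha2 beta2 f).
Proof.
move=> f00 f11; apply: Tscalar_ev_poly; first exact: u2_sym.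
  elim/I3_ind; rewrite /alpha2 /= ?(evM, evX, evC) ?constE.
  - by rewrite Tscalar2_sigma1.
  - by rewrite Tscalar2_tauN1.
  - by rewrite Tscalar2_tauN.
elim/I3_ind; elim/I3_ind; rewrite /beta2 /=; try (by left); right;
  rewrite ?(evD, evM, evX, evC) ?constE ?mul1r ?mulNr.
- exact: Gam2_1Q.
- exact: Gam2_1N.
- by rewrite GamC; exact: Gam2_1Q.
- exact: Gam2_QN.
- by rewrite GamC; exact: Gam2_1N.
- by rewrite GamC; exact: Gam2_QN.
- exact: Gam2_NN.
Qed.

End Tables.

(** * Weight bounds for the transported operator *)

Section WeightsOfT.
Variables (F : numFieldType).
Implicit Types (f : {mpoly F[3]}) (w : 'I_3 -> nat) (d : int).

(** Differentiating in the j-th variable frees weight [w j], and the coefficient [alpha j] spends at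
    most that; [beta j l] does the same for two derivatives. *)
Lemma wle_Tpoly k (w : 'I_k -> nat) d alpha beta (f : {mpoly F[k]}) :
  (forall j, wle w (w j)%:Z (alpha j)) ->
  (forall j l, wle w ((w j)%:Z + (w l)%:Z) (beta j l)) ->
  wle w d f -> wle w d (Tpoly alpha beta f).
Proof.
move=> ha hb fd; rewrite -[d]addr0; apply: wleD; apply: wle_sum => j _.
  by rewrite addr0 -[d](subrK (w j)%:Z); apply: wleM => //; apply: wle_deriv.
apply: wle_sum => l _; rewrite addr0.
rewrite -[d](subrK ((w j)%:Z + (w l)%:Z)); apply: wleM => //.
by rewrite opprD addrA; do 2!apply: wle_deriv.
Qed.

Lemma wleCc k (w : 'I_k -> nat) d (c : F) : 0 <= d -> wle w d (c%:MP : {mpoly F[k]}).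
Proof. by move=> d0; apply: (wleW d0); exact: wleC. Qed.

Lemma wleCX k (w : 'I_k -> nat) d (c : F) j :
  (w j)%:Z <= d -> wle w d (c%:MP * 'X_j : {mpoly F[k]}).
Proof. by move=> jd; rewrite mul_mpolyC; apply/wleZ/(wleW jd)/wleX. Qed.

Lemma wleCXX k (w : 'I_k -> nat) d (c : F) i j :
  (w i)%:Z + (w j)%:Z <= d -> wle w d (c%:MP * ('X_i * 'X_j) : {mpoly F[k]}).
Proof.
by move=> jd; rewrite mul_mpolyC; apply/wleZ/(wleW jd)/wleM; apply: wleX.
Qed.

Ltac wle_entry := lazymatch goal with
  | |- wle _ _ (_ + _) => apply: wleD; wle_entry
  | |- wle _ _ (_ * (_ * _)) => apply: wleCXX; lia
  | |- wle _ _ (_ * _) => apply: wleCX; lia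
  | |- wle _ _ (_%:MP) => apply: wleCc; lia
  | |- _ => exact: wle0
  end.

(** The conditions come from T sigma_3, a multiple of sigma_1, and Gam(sigma_1, sigma_3) = 3
    sigma_2. They hold for the weights [W0] and for the unit weight of sigma_3, so degree in z and
    degree in sigma_3 are treated alike. *)
Lemma wle_T0 N a w d f : (w o0 <= w o2)%N -> (w o1 <= w o0 + w o2)%N ->
  wle w d f -> wle w d (Tpoly (alpha0 N a) (beta0 F N) f).
Proof.
move=> h1 h2; apply: wle_Tpoly; first by elim/I3_ind; rewrite /alpha0 /=; wle_entry.
by elim/I3_ind; elim/I3_ind; rewrite /beta0 /=; wle_entry.
Qed.

Lemma wle_T1 N a w d f : (w o0 <= w o1)%N -> (w o1 <= w o0 + w o1)%N ->
  wle w d f -> wle w d (Tpoly (alpha1 N a) (beta1 F N) f).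
Proof.
move=> h1 h2; apply: wle_Tpoly; first by elim/I3_ind; rewrite /alpha1 /=; wle_entry.
by elim/I3_ind; elim/I3_ind; rewrite /beta1 /=; wle_entry.
Qed.

(** The condition comes from the term -N tau_N in Gam(sigma_1, tau_(N-1)). *)
Lemma wle_T2 N a w d f : (w o2 <= w o0 + w o1)%N ->
  wle w d f -> wle w d (Tpoly (alpha2 N a) (beta2 F N) f).
Proof.
move=> h1; apply: wle_Tpoly; first by elim/I3_ind; rewrite /alpha2 /=; wle_entry.
by elim/I3_ind; elim/I3_ind; rewrite /beta2 /=; wle_entry.
Qed.

End WeightsOfT.

(** * Spin waves *)

Section Waves.
Variables (F : numFieldType) (N m : nat).
Local Notation K := {fraction {mpoly F[N]}}.
Local Notation z := (@zF F N).
Local Notation wave := (wave F N m).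
Local Notation Sigma := (Sigma F N m).
Implicit Types (c : 'S_N -> K) (s : Sigma) (k x : K).

(** [Lambda (tens x s)] with [fperm p x] replaced by an arbitrary family. T involves only
    neighbouring coordinates and in general does not commute with permutations, so it is applied
    summand by summand, and the pieces are identified with generators afterwards. *)
Definition sym_wave c s : wave :=
  [ffun t : config N m => \sum_(p : 'S_N)
     constF N (N`!%:R^-1 * s [ffun i => t (p i)]) * c p].

Lemma sym_wave_ext c c' s : c =1 c' -> sym_wave c s = sym_wave c' s.
Proof.
by move=> cc; apply/ffunP => t; rewrite !ffunE; apply: eq_bigr => p _; rewrite cc.
Qed.

Lemma sym_waveD c c' s :
  sym_wave (fun p => c p + c' p) s = sym_wave c s + sym_wave c' s.
Proof.
apply/ffunP => t; rewrite !ffunE -big_split; apply: eq_bigr => p _.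
by rewrite mulrDr.
Qed.

Lemma sym_waveZ k c s : k *: sym_wave c s = sym_wave (fun p => k * c p) s.
Proof.
apply/ffunP => t; rewrite !ffunE /= [LHS]mulr_sumr; apply: eq_bigr => p _.
by rewrite mulrCA.
Qed.

Lemma Lambda_tens x s : Lambda (tens x s) = sym_wave (fun p => fperm p x) s.
Proof.
apply/ffunP => t; rewrite !ffunE /= sum_ffunE [LHS]mulr_sumr; apply: eq_bigr => p _.
by rewrite !ffunE fpermM fperm_const rmorphM /= -mulrA [fperm p x * _]mulrC.
Qed.

Lemma Top_sym_wave a eps c s :
  Top a eps (sym_wave c s) = sym_wave (fun p => Tscalar a eps (c p)) s.
Proof.
apply/ffunP => t; rewrite !ffunE raddf_sum; apply: eq_bigr => p _ /=.
by rewrite TscalarMl.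
Qed.

Lemma Top_sum a eps (I : finType) (c : I -> F) (v : I -> wave) :
  Top a eps (\sum_i constF N (c i) *: v i) = \sum_i constF N (c i) *: Top a eps (v i).
Proof.
apply/ffunP => t; rewrite ffunE !sum_ffunE raddf_sum; apply: eq_bigr => i _ /=.
by rewrite !ffunE [LHS]TscalarMl.
Qed.

Section Span.
Variable G : wave -> Prop.

Lemma Fspan_gen v : G v -> Fspan G v.
Proof.
move=> Gv; exists 1%N, (fun=> 1), (fun=> v); split=> //.
by rewrite big_ord1 rmorph1 scale1r.
Qed.

Lemma FspanD v w : Fspan G v -> Fspan G w -> Fspan G (v + w).
Proof.
move=> [k1 [c1 [v1 [G1 ->]]]] [k2 [c2 [v2 [G2 ->]]]].
exists (k1 + k2)%N, (fun i => match split i with inl j => c1 j | inr j => c2 j end),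
  (fun i => match split i with inl j => v1 j | inr j => v2 j end); split.
  by move=> i; case: split.
rewrite big_split_ord; congr (_ + _); apply: eq_bigr => i _.
  by rewrite (unsplitK (inl i)).
by rewrite (unsplitK (inr i)).
Qed.

Lemma Fspan0 : Fspan G 0.
Proof. by exists 0%N, (fun=> 0), (fun=> 0); split=> [[]//|]; rewrite big_ord0. Qed.

Lemma FspanZ (c : F) v : Fspan G v -> Fspan G (constF N c *: v).
Proof.
move=> [k [c1 [v1 [G1 ->]]]]; exists k, (fun i => c * c1 i), v1; split=> //.
by rewrite scaler_sumr; apply: eq_bigr => i _; rewrite scalerA rmorphM.
Qed.

Lemma Top_Fspan a eps : (forall v, G v -> Fspan G (Top a eps v)) ->
  forall v, Fspan G v -> Fspan G (Top a eps v).
Proof.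
move=> GT v [k [c [v1 [G1 ->]]]]; rewrite Top_sum.
by elim/big_ind: _ => [||i _]; [exact: Fspan0 | exact: FspanD | exact/FspanZ/GT].
Qed.

End Span.

Hypothesis hN : (2 < N)%N.
Local Notation p1 := (pos1 hN).
Local Notation p2 := (pos2 hN).
Local Notation nxt := (@ordS N).

(** Reindexing by the transposition of the first two positions moves it onto the spins: z_2 with |s>
    symmetrizes to z_1 with S_12|s>. Generators in z_1 therefore suffice. *)
Lemma sym_wave_swap (g : 'I_N -> K) s :
  sym_wave (fun p => g (p p2)) s =
  sym_wave (fun p => g (p p1)) (spin_perm (tperm p1 p2) s).
Proof.
apply/ffunP => t; rewrite !ffunE (reindex_inj (mulgI (tperm p1 p2))).
apply: eq_bigr => p _; rewrite permM tpermR; congr (constF N (_ * _) * _).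
rewrite ffunE; congr (s _); apply/ffunP => i; by rewrite !ffunE permM.
Qed.

(** The two indicators are the two terms of 1 + S_12 in |s^+>. Summing over i removes the prescribed
    values of p(1) and p(2) and keeps only that they are neighbours. *)
Lemma sym_wave_adjacent s (u : Sigma) :
  \sum_(i < N) splus hN i (nxt i) s = LambdaSigma u ->
  sym_wave (fun p => (p p2 == nxt (p p1))%:R + (p p1 == nxt (p p2))%:R) s
  = sym_wave (fun=> 1) u.
Proof.
move=> e; apply/ffunP => t.
have -> : sym_wave (fun=> 1) u t = constF N (LambdaSigma u t).
  rewrite !ffunE sum_ffunE [_ *: _]mulr_sumr rmorph_sum.
  by apply: eq_bigr => p _; rewrite ffunE mulr1.
rewrite -e sum_ffunE !ffunE.
transitivity (constF N (\sum_(p : 'S_N) N`!%:R^-1 * s [ffun i => t (p i)] *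
    ((p p2 == nxt (p p1))%:R + (p p1 == nxt (p p2))%:R))).
  rewrite rmorph_sum; apply: eq_bigr => p _.
  by rewrite /= [RHS](rmorphM (@constF F N)) /= raddfD /= !(rmorph_nat (@constF F N)).
congr constF.
under [RHS]eq_bigr => i _.
  rewrite !ffunE sum_ffunE [_ *: _]mulr_sumr.
  under eq_bigr do rewrite !ffunE mulrDr.
  rewrite big_split /=; over.
rewrite big_split /=.
have sub (g : 'S_N -> F) :
    \sum_i \sum_(p : 'S_N | (p p1 == i) && (p p2 == nxt i)) g p =
    \sum_(p : 'S_N) (p p2 == nxt (p p1))%:R * g p.
  rewrite (exchange_big_dep xpredT) //=; apply: eq_bigr => p _.
  rewrite (eq_bigl (fun i => (i == p p1) && (p p2 == nxt i))) => [|i]; last first.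
    by rewrite eq_sym.
  rewrite big_mkcondr big_pred1_eq /=.
  by case: eqP; rewrite ?mul1r ?mul0r.
(* Reindexing by the transposition undoes S_12 on the spins and exchanges the positions 1 and 2 in
   the indicator. *)
rewrite !sub [X in _ = _ + X](reindex_inj (mulgI (tperm p1 p2))) -big_split.
apply: eq_bigr => p _ /=; rewrite !permM tpermL tpermR.
rewrite mulrDr ![_ * _%:R]mulrC; congr (_ + _ * (_ * s _)).
by apply/ffunP => i; rewrite !ffunE !permM tpermK.
Qed.

End Waves.

Section MoreWeights.
Variables (F : numFieldType) (k : nat).
Implicit Types (f g : {mpoly F[k]}) (w : 'I_k -> nat) (d e : int).

Lemma wle_derivW w d e j f : wle w d f -> d - (w j)%:Z <= e -> wle w e f^`M(j).
Proof. by move=> fd de; apply: (wleW de); apply: wle_deriv. Qed.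

Lemma wleCM w d (c : F) f : wle w d f -> wle w d (c%:MP * f).
Proof. by move=> fd; rewrite mul_mpolyC; apply: wleZ. Qed.

Lemma wle_XM w d e j f : wle w e f -> (w j)%:Z + e <= d -> wle w d ('X_j * f).
Proof. by move=> fe h; apply: (wleW h); apply: wleM fe; apply: wleX. Qed.

(** Combined with [wle_comp], zero weights show that a variable absent from the substituted
    polynomials is absent from the composite. *)
Lemma wle_zero d f : 0 <= d -> wle (fun=> 0%N) d f.
Proof. by move=> d0 m _; rewrite /wdeg big1. Qed.

Lemma wle_sub w d f g : {subset msupp g <= msupp f} -> wle w d f -> wle w d g.
Proof. by move=> gf fd m /gf /fd. Qed.

Lemma mderiv_eq0 j f : wle (wunit j) 0 f -> f^`M(j) = 0.
Proof.
move=> f0; apply: (@wle_lt0 _ _ (wunit j) (0 - (wunit j j)%:Z)).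
  by rewrite /wunit eqxx.
exact: wle_deriv.
Qed.

End MoreWeights.

Lemma sumI3 (V : nmodType) (G : 'I_3 -> V) : \sum_j G j = G o0 + G o1 + G o2.
Proof.
rewrite !big_ord_recl big_ord0 addr0 addrA.
by congr (G _ + G _ + G _); apply: val_inj.
Qed.

Lemma inord3E : (inord 0 = o0 :> 'I_3) * (inord 1 = o1 :> 'I_3) * (inord 2 = o2 :> 'I_3).
Proof. by split; [split|]; apply: val_inj; rewrite /= inordK. Qed.

Local Notation i0 := (@Ordinal 2 0 isT).
Local Notation i1 := (@Ordinal 2 1 isT).

Lemma I2_ind (P : 'I_2 -> Prop) : P i0 -> P i1 -> forall j, P j.
Proof.
move=> P0 P1 [[|[|//]] h].
  by rewrite (_ : Ordinal h = i0) //; apply: val_inj.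
by rewrite (_ : Ordinal h = i1) //; apply: val_inj.
Qed.

Lemma inord2E : (inord 0 = i0 :> 'I_2) * (inord 1 = i1 :> 'I_2).
Proof. by split; apply: val_inj; rewrite /= inordK. Qed.

(** * Passing between two and three generators *)

Section Membership.
Variables (F : numFieldType) (N : nat) (u : 3.-tuple {mpoly F[N]}) (W : 'I_3 -> nat).
Hypothesis uhom : forall j, tnth u j \is (W j).-homog.

(* A polynomial in two of the three generators is treated as a polynomial in all
   three which has degree 0 in the missing one. *)
Lemma narrow_args (w : 'I_3 -> nat) (v : 3.-tuple {mpoly F[2]})
    (u' : 2.-tuple {mpoly F[N]}) f :
  wle w 0 f -> (forall j, w j = 0%N -> tnth v j \mPo u' = tnth u j) ->
  (f \mPo v) \mPo u' = f \mPo u.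
Proof.
move=> f0 vu; rewrite comp_mpoly_comp; apply: eq_comp_wle0 f0 _ => j wj.
by rewrite tnth_mktuple vu.
Qed.

(** Terms of too high weight are truncated after the embedding. Truncation only drops monomials, so
    degree 0 in the added variable survives. *)
Lemma widen_args (v : 2.-tuple {mpoly F[3]}) (u' : 2.-tuple {mpoly F[N]}) d
    (h : {mpoly F[2]}) :
  (forall j, tnth v j \mPo u = tnth u' j) -> deg_le (h \mPo u') d ->
  exists f : {mpoly F[3]}, [/\ ev u f = (h \mPo u')%:F, wle W d f
    & {subset msupp f <= msupp (h \mPo v)}].
Proof.
move=> vu hd; have e : (h \mPo v) \mPo u = h \mPo u'.
  rewrite comp_mpoly_comp; congr (h \mPo _); apply: eq_from_tnth => j.
  by rewrite tnth_mktuple vu.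
rewrite -e in hd; have [f [fe fd fs]] := truncation uhom hd.
by exists f; split=> //; rewrite /ev fe e.
Qed.

End Membership.

(** * Gradient pairings with a coordinate *)

Section Gradients.
Variables (F : numFieldType) (N : nat).
Hypothesis N1 : (1 < N)%N.
Local Notation K := {fraction {mpoly F[N]}}.
Local Notation z := (@zF F N).
Local Notation P := ((tau F N N)%:F : K).
Local Notation Q := ((tau F N N.-1)%:F : K).

Lemma Gam_ev k (u : k.-tuple {mpoly F[N]}) eps x f :
  Gam eps x (ev u f) = \sum_j ev u f^`M(j) * Gam eps x (tnth u j)%:F.
Proof.
rewrite /Gam; under [RHS]eq_bigr => j _ do rewrite mulr_sumr.
rewrite exchange_big; apply: eq_bigr => i _; rewrite fderiv_ev mulr_sumr.
by apply: eq_bigr => j _; rewrite mulrCA.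
Qed.

(** sigma_3 contributes z_k^2. The coefficient of z_1 may thus involve sigma_3, since z_1^2 is
    available, but that of z_1^2 may not, since z_1^3 is not. *)
Lemma Gam0_z f k : Gam 0 (ev (u0 F N) f) (z k) =
  ev (u0 F N) f^`M(o0) + 2 * z k * ev (u0 F N) f^`M(o1)
  + 3 * z k ^+ 2 * ev (u0 F N) f^`M(o2).
Proof.
rewrite GamC Gam_ev sumI3 /= !(GamC _ (z k)) !Gam_z.
rewrite fderiv_sigma1 fderiv_sigma2 fderiv_sigma3.
by move: (ev _ _) (ev _ _) (ev _ _) => *; ring.
Qed.

(** sigma_2 contributes z_k^2, for which epsilon = 1 has no generator; hence g depends on sigma_1
    and tau_N only. *)
Lemma Gam1_z f k : Gam 1 (ev (u1 F N) f) (z k) =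
  z k * ev (u1 F N) f^`M(o0) + 2 * z k ^+ 2 * ev (u1 F N) f^`M(o1)
  + P * ev (u1 F N) f^`M(o2).
Proof.
rewrite GamC Gam_ev sumI3 /= !(GamC _ (z k)) !Gam_z.
rewrite fderiv_sigma1 fderiv_sigma2 !expr1 z_fderiv_tauN.
by move: (ev _ _) (ev _ _) (ev _ _) => *; ring.
Qed.

(** sigma_1 contributes z_k^2, hence g omits it. The -tau_N from tau_(N-1) would give a term in
    z_k^-2 when paired with 1/z_k, hence q omits tau_(N-1). *)
Lemma Gam2_z f k : Gam 2 (ev (u2 F N) f) (z k) =
  z k ^+ 2 * ev (u2 F N) f^`M(o0) + (z k * Q - P) * ev (u2 F N) f^`M(o1)
  + P * z k * ev (u2 F N) f^`M(o2).
Proof.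
rewrite GamC Gam_ev sumI3 /= !(GamC _ (z k)) !Gam_z.
rewrite fderiv_sigma1 z2_fderiv_tauN1 // z2_fderiv_tauN.
by move: (ev _ _) (ev _ _) (ev _ _) => *; ring.
Qed.

End Gradients.

Section SpanOfWaves.
Variables (F : numFieldType) (N m : nat) (G : wave F N m -> Prop).

Lemma Fspan_waveD c c' s : Fspan G (sym_wave c s) -> Fspan G (sym_wave c' s) ->
  Fspan G (sym_wave (fun p => c p + c' p) s).
Proof. by rewrite sym_waveD; exact: FspanD. Qed.

Lemma Fspan_wave_ext c c' (s : Sigma F N m) : c =1 c' ->
  Fspan G (sym_wave c' s) -> Fspan G (sym_wave c s).
Proof. by move=> /sym_wave_ext->. Qed.

End SpanOfWaves.

Ltac weight_lia := rewrite ?/wunit ?/W0 ?/W1 ?/W2 /=; lia.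

(** Degree in z, degree at most 1 and degree 0 in a variable are all [wle] goals. The recursion
    follows the shape of the polynomial and leaves integer inequalities between weights. *)
Ltac weight_bound := lazymatch goal with
  | |- wle _ _ (_ + _) => apply: wleD; weight_bound
  | |- wle _ _ (_%:MP * _) => apply: wleCM; weight_bound
  | |- wle _ _ (Tpoly (alpha0 _ _) _ _) =>
      apply: wle_T0; [weight_lia | weight_lia | weight_bound]
  | |- wle _ _ (Tpoly (alpha1 _ _) _ _) =>
      apply: wle_T1; [weight_lia | weight_lia | weight_bound]
  | |- wle _ _ (Tpoly (alpha2 _ _) _ _) => apply: wle_T2; [weight_lia | weight_bound]
  | |- wle _ _ ('X__ * _) => eapply wle_XM; [weight_bound | weight_lia]
  | H : wle ?w _ ?f |- wle ?w _ (mderiv _ ?f) =>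
      eapply wle_derivW; [exact H | first [exact: lexx | weight_lia]]
  | H : wle ?w _ ?f |- wle ?w _ ?f =>
      eapply wleW; [| exact H]; first [exact: lexx | weight_lia]
  end.

(** * The three invariant spaces *)

Section EpsilonZero.
Variables (F : numFieldType) (N m : nat) (hN : (2 < N)%N) (n : int) (a : F).
Local Notation K := {fraction {mpoly F[N]}}.
Local Notation z := (@zF F N).
Local Notation ev0 := (ev (u0 F N)).
Local Notation p1 := (pos1 hN).
Local Notation p2 := (pos2 hN).
Local Notation G := (@Defs.gen0 F N m hN n).
Implicit Types (f : {mpoly F[3]}) (s : Sigma F N m).
Let N1 : (1 < N)%N := ltnW hN.

(** The entry 0 is a filler: [v0] is substituted only into polynomials of degree 0 in the third
    variable. *)
Definition v0 : 3.-tuple {mpoly F[2]} := [tuple 'X_i0; 'X_i1; 0].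
Definition v0' : 2.-tuple {mpoly F[3]} := [tuple 'X_o0; 'X_o1].

Lemma narrow0 f : wle (wunit o2) 0 f ->
  ev0 f = ((f \mPo v0) \mPo [tuple sigma F N 1; sigma F N 2])%:F.
Proof.
move=> f0; rewrite (narrow_args (u := u0 F N) f0) //.
by elim/I3_ind => //= _; rewrite /v0 /= comp_mpolyXU.
Qed.

Lemma span0_const f s : wle W0 n f -> wle (wunit o2) 1 f ->
  Fspan G (sym_wave (fun=> ev0 f) s).
Proof.
move=> fn f2; apply: Fspan_gen.
have -> : sym_wave (fun=> ev0 f) s = ev0 f *: Lambda (tens 1 s).
  by rewrite Lambda_tens sym_waveZ; apply: sym_wave_ext => p; rewrite rmorph1 mulr1.
apply: Gen0f; first by rewrite inord3E; apply/d2_eq0.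
exact: deg_le_comp (@u0_hom F N) _ _ fn.
Qed.

Lemma span0_z1 f s : wle W0 (n - 1) f -> wle (wunit o2) 1 f ->
  Fspan G (sym_wave (fun p => ev0 f * z (p p1)) s).
Proof.
move=> fn f2; apply: Fspan_gen.
have -> : sym_wave (fun p => ev0 f * z (p p1)) s = ev0 f *: Lambda (tens (z p1) s).
  by rewrite Lambda_tens sym_waveZ; apply: sym_wave_ext => p; rewrite fperm_z.
apply: Gen0g; first by rewrite inord3E; apply/d2_eq0.
exact: deg_le_comp (@u0_hom F N) _ _ fn.
Qed.

Lemma span0_z2 f s : wle W0 (n - 1) f -> wle (wunit o2) 1 f ->
  Fspan G (sym_wave (fun p => ev0 f * z (p p2)) s).
Proof.
by move=> fn f2; rewrite (sym_wave_swap hN (fun i => ev0 f * z i)); apply: span0_z1.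
Qed.

Lemma span0_sqr1 f s : wle W0 (n - 2) f -> wle (wunit o2) 0 f ->
  Fspan G (sym_wave (fun p => ev0 f * z (p p1) ^+ 2) s).
Proof.
move=> fn f2; apply: Fspan_gen.
have -> : sym_wave (fun p => ev0 f * z (p p1) ^+ 2) s = ev0 f *: Lambda (tens (z p1 ^+ 2) s).
  by rewrite Lambda_tens sym_waveZ; apply: sym_wave_ext => p; rewrite rmorphXn /= fperm_z.
rewrite narrow0 //; apply: Gen0h; rewrite (narrow_args (u := u0 F N) f2).
  exact: deg_le_comp (@u0_hom F N) _ _ fn.
by elim/I3_ind => //= _; rewrite /v0 /= comp_mpolyXU.
Qed.

Lemma fperm_prod12 p : fperm p (z p1 * z p2) = z (p p1) * z (p p2).
Proof. exact: fperm_zz. Qed.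

Lemma fperm_cubic12 p : fperm p (z p1 * z p2 * (z p1 - z p2)) =
  z (p p1) * z (p p2) * (z (p p1) - z (p p2)).
Proof. exact: fperm_cubic. Qed.

Lemma span0_sqr2 f s : wle W0 (n - 2) f -> wle (wunit o2) 0 f ->
  Fspan G (sym_wave (fun p => ev0 f * z (p p2) ^+ 2) s).
Proof.
by move=> fn f2; rewrite (sym_wave_swap hN (fun i => ev0 f * z i ^+ 2)); apply: span0_sqr1.
Qed.

Lemma span0_prod f s : wle W0 (n - 2) f -> wle (wunit o2) 0 f -> Sigma' hN s ->
  Fspan G (sym_wave (fun p => ev0 f * (z (p p1) * z (p p2))) s).
Proof.
move=> fn f2 s'; apply: Fspan_gen.
have -> : sym_wave (fun p => ev0 f * (z (p p1) * z (p p2))) s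
    = ev0 f *: Lambda (tens (z p1 * z p2) s).
  by rewrite Lambda_tens sym_waveZ; apply: sym_wave_ext => p; rewrite fperm_prod12.
rewrite narrow0 //; apply: Gen0h' => //; rewrite (narrow_args (u := u0 F N) f2).
  exact: deg_le_comp (@u0_hom F N) _ _ fn.
by elim/I3_ind => //= _; rewrite /v0 /= comp_mpolyXU.
Qed.

Lemma span0_cubic f s : wle W0 (n - 3) f -> wle (wunit o2) 0 f ->
  Fspan G (sym_wave (fun p =>
    ev0 f * (z (p p1) * z (p p2) * (z (p p1) - z (p p2)))) s).
Proof.
move=> fn f2; apply: Fspan_gen.
have -> : sym_wave (fun p => ev0 f * (z (p p1) * z (p p2) * (z (p p1) - z (p p2)))) s
    = ev0 f *: Lambda (tens (z p1 * z p2 * (z p1 - z p2)) s).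
  by rewrite Lambda_tens sym_waveZ; apply: sym_wave_ext => p; rewrite fperm_cubic12.
rewrite narrow0 //; apply: Gen0w; rewrite (narrow_args (u := u0 F N) f2).
  exact: deg_le_comp (@u0_hom F N) _ _ fn.
by elim/I3_ind => //= _; rewrite /v0 /= comp_mpolyXU.
Qed.

Lemma widen0 d (h : {mpoly F[2]}) :
  deg_le (h \mPo [tuple sigma F N 1; sigma F N 2]) d ->
  exists f, [/\ ev0 f = (h \mPo [tuple sigma F N 1; sigma F N 2])%:F,
    wle W0 d f & wle (wunit o2) 0 f].
Proof.
have vu j : tnth v0' j \mPo u0 F N = tnth [tuple sigma F N 1; sigma F N 2] j.
  by elim/I2_ind: j; rewrite /= comp_mpolyXU.
move=> /(widen_args (@u0_hom F N) vu)[f [fe fd fs]]; exists f; split=> //.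
apply: (wle_sub fs); apply: (@wle_comp _ _ _ (fun=> 0%N)); last exact: wle_zero.
by elim/I2_ind => /=; exact: wleX.
Qed.

Lemma trunc0 d f : d2 (inord 2) f = 0 ->
  deg_le (f \mPo [tuple sigma F N 1; sigma F N 2; sigma F N 3]) d ->
  exists g, [/\ ev0 g = (f \mPo [tuple sigma F N 1; sigma F N 2; sigma F N 3])%:F,
    wle W0 d g & wle (wunit o2) 1 g].
Proof.
rewrite inord3E => /d2_eq0 f2 /(truncation (@u0_hom F N))[g [ge gd gs]].
by exists g; split; [rewrite /ev ge | | apply: wle_sub f2].
Qed.

(** Converse of the [span0] lemmas: each generator has a normal form with a three-variable
    coefficient and formal weight bounds. *)
Lemma gen0_elim (Pr : wave F N m -> Prop) :
  (forall f s, wle W0 n f -> wle (wunit o2) 1 f -> Pr (sym_wave (fun=> ev0 f) s)) ->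
  (forall f s, wle W0 (n - 1) f -> wle (wunit o2) 1 f ->
     Pr (sym_wave (fun p => ev0 f * z (p p1)) s)) ->
  (forall f s, wle W0 (n - 2) f -> wle (wunit o2) 0 f ->
     Pr (sym_wave (fun p => ev0 f * z (p p1) ^+ 2) s)) ->
  (forall f s, wle W0 (n - 2) f -> wle (wunit o2) 0 f -> Sigma' hN s ->
     Pr (sym_wave (fun p => ev0 f * (z (p p1) * z (p p2))) s)) ->
  (forall f s, wle W0 (n - 3) f -> wle (wunit o2) 0 f ->
     Pr (sym_wave (fun p =>
       ev0 f * (z (p p1) * z (p p2) * (z (p p1) - z (p p2)))) s)) ->
  forall v, G v -> Pr v.
Proof.
move=> Hf Hg Hh Hq Hw v [f s fz f2 fd|f s fz f2 fd|h s hz hd|h s hz s' hd|h s hz hd].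
- have [g [<- gd g2]] := trunc0 f2 fd; rewrite Lambda_tens sym_waveZ.
  rewrite (@sym_wave_ext _ _ _ _ (fun=> ev0 g)) => [|p]; first exact: Hf.
  by rewrite rmorph1 mulr1.
- have [g [<- gd g2]] := trunc0 f2 fd; rewrite Lambda_tens sym_waveZ.
  rewrite (@sym_wave_ext _ _ _ _ (fun p => ev0 g * z (p p1))) => [|p]; first exact: Hg.
  by rewrite fperm_z.
- have [g [<- gd g2]] := widen0 hd; rewrite Lambda_tens sym_waveZ.
  rewrite (@sym_wave_ext _ _ _ _ (fun p => ev0 g * z (p p1) ^+ 2)) => [|p].
    exact: Hh.
  by rewrite rmorphXn /= fperm_z.
- have [g [<- gd g2]] := widen0 hd; rewrite Lambda_tens sym_waveZ.
  rewrite (@sym_wave_ext _ _ _ _ (fun p => ev0 g * (z (p p1) * z (p p2)))) => [|p].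
    exact: Hq.
  by rewrite fperm_prod12.
have [g [<- gd g2]] := widen0 hd; rewrite Lambda_tens sym_waveZ.
rewrite (@sym_wave_ext _ _ _ _
  (fun p => ev0 g * (z (p p1) * z (p p2) * (z (p p1) - z (p p2))))) => [|p].
  exact: Hw.
by rewrite fperm_cubic12.
Qed.

Definition T0 := Tpoly (alpha0 N a) (beta0 F N).

Lemma T0E f : wle (wunit o2) 1 f -> Tscalar a 0 (ev0 f) = ev0 (T0 f).
Proof. by move=> f2; apply: Tscalar_ev0 => //; apply/d2_eq0. Qed.

Lemma wle_weak01 f : wle (wunit o2) 0 f -> wle (wunit o2) 1 f.
Proof. exact: wleW. Qed.

Local Notation ac := (constF N a).

(** Pairing with sigma_2 is twice the Euler operator, so the sigma_2-derivative gets four times the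
    degree of the monomial: 4 here, 8 and 12 below. *)
Lemma T0_z f k : wle (wunit o2) 1 f ->
  Tscalar a 0 (ev0 f * z k) =
    (ev0 (T0 f + 4%:MP * f^`M(o1)) * z k + ev0 (2%:MP * f^`M(o0)))
    + ev0 (6%:MP * f^`M(o2)) * z k ^+ 2.
Proof.
move=> f2; rewrite TscalarM => [|s]; last by apply: ev_sym => j; exact: u0_sym.
rewrite T0E // Tscalar_z // Gam0_z !(evD, evM, evC) ?constE /=.
by move: (ev0 _) (ev0 _) (ev0 _) (ev0 _) (ev0 _) => *; ring.
Qed.

Lemma Gam0_z0 f k : wle (wunit o2) 0 f ->
  Gam 0 (ev0 f) (z k) = ev0 f^`M(o0) + 2 * z k * ev0 f^`M(o1).
Proof.
by move=> f2; rewrite Gam0_z (mderiv_eq0 f2) (raddf0 ev0) mulr0 addr0.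
Qed.

Lemma T0_sqr f k : wle (wunit o2) 0 f ->
  Tscalar a 0 (ev0 f * z k ^+ 2) =
    (ev0 (T0 f + 8%:MP * f^`M(o1)) * z k ^+ 2 + ev0 ((2 + 4 * a)%:MP * f))
    + ev0 (4%:MP * f^`M(o0)) * z k.
Proof.
move=> f2; rewrite TscalarM => [|s]; last by apply: ev_sym => j; exact: u0_sym.
rewrite (T0E (wle_weak01 f2)) Tscalar_sqr // {2}expr2 GamM Gam0_z0 //.
rewrite !(evD, evM, evC) ?constE /=.
by move: (ev0 _) (ev0 _) (ev0 _) (ev0 _) => *; ring.
Qed.

Lemma T0_prod f k l : wle (wunit o2) 0 f -> k != l ->
  Tscalar a 0 (ev0 f * (z k * z l)) =
    (ev0 (T0 f + 8%:MP * f^`M(o1)) * (z k * z l)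
     + ev0 ((- (2 * a))%:MP * f) * ((l == ordS k)%:R + (k == ordS l)%:R))
    + (ev0 (2%:MP * f^`M(o0)) * z k + ev0 (2%:MP * f^`M(o0)) * z l).
Proof.
move=> f2 kl; rewrite TscalarM => [|s]; last by apply: ev_sym => j; exact: u0_sym.
rewrite (T0E (wle_weak01 f2)) Tscalar_zz // GamM !Gam0_z0 //.
rewrite !(evD, evM, evC) ?constE /=.
move: (ev0 _) (ev0 _) (ev0 _) (ev0 _) (l == _)%:R (k == _)%:R => *; ring.
Qed.

(** The sigma_1-derivative multiplies the translation derivative of the cubic, z_k^2 - z_l^2. Its
    z_k z_l terms cancel, which matters because products are available only for spin states in
    [Sigma']. *)
Lemma T0_cubic f k l : wle (wunit o2) 0 f -> k != l ->
  Tscalar a 0 (ev0 f * (z k * z l * (z k - z l))) =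
    (ev0 (T0 f + 12%:MP * f^`M(o1)) * (z k * z l * (z k - z l))
     + (ev0 ((- (2 + 4 * a))%:MP * f) * z k + ev0 ((2 + 4 * a)%:MP * f) * z l))
    + (ev0 (2%:MP * f^`M(o0)) * z k ^+ 2 + ev0 ((- 2)%:MP * f^`M(o0)) * z l ^+ 2).
Proof.
move=> f2 kl; rewrite TscalarM => [|s]; last by apply: ev_sym => j; exact: u0_sym.
rewrite (T0E (wle_weak01 f2)) Tscalar_cubic // !(GamM, GamB) !Gam0_z0 //.
rewrite !(evD, evM, evC) ?constE /=.
by move: (ev0 _) (ev0 _) (ev0 _) (ev0 _) => *; ring.
Qed.

Let p12 (p : 'S_N) : p p1 != p p2.
Proof. by rewrite (inj_eq perm_inj). Qed.

Lemma gen0_invariant v : Fspan G v -> Fspan G (Top a 0 v).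
Proof.
apply: Top_Fspan; apply: gen0_elim => f s.
- move=> fn f2; rewrite Top_sym_wave.
  apply: Fspan_wave_ext => [p|]; first exact: T0E.
  by apply: span0_const; rewrite /T0; weight_bound.
- move=> fn f2; rewrite Top_sym_wave.
  apply: Fspan_wave_ext => [p|]; first exact: T0_z.
  apply: Fspan_waveD; first apply: Fspan_waveD.
  + by apply: span0_z1; rewrite /T0; weight_bound.
  + by apply: span0_const; weight_bound.
  + by apply: span0_sqr1; weight_bound.
- move=> fn f2; rewrite Top_sym_wave.
  apply: Fspan_wave_ext => [p|]; first exact: T0_sqr.
  apply: Fspan_waveD; first apply: Fspan_waveD.
  + by apply: span0_sqr1; rewrite /T0; weight_bound.
  + by apply: span0_const; weight_bound.
  + by apply: span0_z1; weight_bound.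
- move=> fn f2 s'; rewrite Top_sym_wave.
  apply: Fspan_wave_ext => [p|]; first exact: T0_prod f2 (p12 p).
  apply: Fspan_waveD; apply: Fspan_waveD.
  + by apply: span0_prod; rewrite /T0 //; weight_bound.
  (* [Sigma'] supplies a state [w] whose constant wave equals the neighbour indicators on [s], so
     this term is a generator of the first kind. *)
  + have [w e] := s'; rewrite -sym_waveZ (sym_wave_adjacent e) sym_waveZ.
    apply: (@Fspan_wave_ext _ _ _ _ _ (fun=> ev0 ((- (2 * a))%:MP * f))) => [p|].
      by rewrite mulr1.
    by apply: span0_const; weight_bound.
  + by apply: span0_z1; weight_bound.
  + by apply: span0_z2; weight_bound.
move=> fn f2; rewrite Top_sym_wave.
apply: Fspan_wave_ext => [p|]; first exact: T0_cubic f2 (p12 p).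
apply: Fspan_waveD; first (apply: Fspan_waveD; last apply: Fspan_waveD);
  last apply: Fspan_waveD.
- by apply: span0_cubic; rewrite /T0; weight_bound.
- by apply: span0_z1; weight_bound.
- by apply: span0_z2; weight_bound.
- by apply: span0_sqr1; weight_bound.
- by apply: span0_sqr2; weight_bound.
Qed.
End EpsilonZero.

(** * The case epsilon = 1 *)

Section EpsilonOne.
Variables (F : numFieldType) (N m : nat) (hN : (2 < N)%N) (n : int) (a : F).
Local Notation K := {fraction {mpoly F[N]}}.
Local Notation z := (@zF F N).
Local Notation ev1 := (ev (u1 F N)).
Local Notation p1 := (pos1 hN).
Local Notation G := (@Defs.gen1 F N m hN n).
Implicit Types (f : {mpoly F[3]}) (s : Sigma F N m).
Let N1 : (1 < N)%N := ltnW hN.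
Local Notation ac := (constF N a).
Local Notation P := ((tau F N N)%:F : K).

Definition v1 : 3.-tuple {mpoly F[2]} := [tuple 'X_i0; 0; 'X_i1].
Definition v1' : 2.-tuple {mpoly F[3]} := [tuple 'X_o0; 'X_o2].

Lemma narrow1 f : wle (wunit o1) 0 f ->
  (f \mPo v1) \mPo [tuple sigma F N 1; tau F N N] = f \mPo u1 F N.
Proof.
move=> f0; apply: narrow_args f0 _.
by elim/I3_ind => //= _; rewrite /v1 /= comp_mpolyXU.
Qed.

Lemma span1_const f s : wle (W1 N) n f -> wle (wunit o1) 1 f -> wle (wunit o2) 1 f ->
  Fspan G (sym_wave (fun=> ev1 f) s).
Proof.
move=> fn f1 f2; apply: Fspan_gen.
have -> : sym_wave (fun=> ev1 f) s = ev1 f *: Lambda (tens 1 s).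
  by rewrite Lambda_tens sym_waveZ; apply: sym_wave_ext => p; rewrite rmorph1 mulr1.
apply: Gen1f; [by rewrite inord3E; apply/d2_eq0 | by rewrite inord3E; apply/d2_eq0 |].
exact: deg_le_comp (@u1_hom F N) _ _ fn.
Qed.

Lemma span1_z1 f s : wle (W1 N) (n - 1) f -> wle (wunit o1) 0 f -> wle (wunit o2) 1 f ->
  Fspan G (sym_wave (fun p => ev1 f * z (p p1)) s).
Proof.
move=> fn f1 f2; apply: Fspan_gen.
have -> : sym_wave (fun p => ev1 f * z (p p1)) s = ev1 f *: Lambda (tens (z p1) s).
  by rewrite Lambda_tens sym_waveZ; apply: sym_wave_ext => p; rewrite fperm_z.
rewrite /ev -narrow1 //; apply: Gen1g; last first.
  by rewrite narrow1 //; exact: deg_le_comp (@u1_hom F N) _ _ fn.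
rewrite inord2E; apply/d2_eq0; apply: wle_comp f2.
by elim/I3_ind => /=; first [exact: wleX | exact: wle0].
Qed.

Lemma gen1_elim (Pr : wave F N m -> Prop) :
  (forall f s, wle (W1 N) n f -> wle (wunit o1) 1 f -> wle (wunit o2) 1 f ->
     Pr (sym_wave (fun=> ev1 f) s)) ->
  (forall f s, wle (W1 N) (n - 1) f -> wle (wunit o1) 0 f -> wle (wunit o2) 1 f ->
     Pr (sym_wave (fun p => ev1 f * z (p p1)) s)) ->
  forall v, G v -> Pr v.
Proof.
move=> Hf Hg v [f s fz f1 f2 fd|h s hz h1 hd].
  rewrite inord3E in f1; rewrite inord3E in f2.
  have [g [ge gd gs]] := truncation (@u1_hom F N) fd.
  rewrite Lambda_tens sym_waveZ (@sym_wave_ext _ _ _ _ (fun=> ev1 g)) => [|p].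
    by apply: Hf => //; apply: (wle_sub gs); apply/d2_eq0.
  by rewrite rmorph1 mulr1 /ev ge.
have vu j : tnth v1' j \mPo u1 F N = tnth [tuple sigma F N 1; tau F N N] j.
  by elim/I2_ind: j; rewrite /= comp_mpolyXU.
have [g [ge gd gs]] := widen_args (@u1_hom F N) vu hd.
rewrite Lambda_tens sym_waveZ.
rewrite (@sym_wave_ext _ _ _ _ (fun p => ev1 g * z (p p1))) => [|p]; last first.
  by rewrite fperm_z ge.
apply: Hg => //; apply: (wle_sub gs).
  apply: (@wle_comp _ _ _ (fun=> 0%N)); last exact: wle_zero.
  by elim/I2_ind => /=; exact: wleX.
rewrite inord2E in h1; move/d2_eq0: h1; apply: wle_comp.
by elim/I2_ind => /=; exact: wleX.
Qed.

Definition T1 := Tpoly (alpha1 N a) (beta1 F N).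

Lemma T1E f : wle (wunit o1) 1 f -> wle (wunit o2) 1 f ->
  Tscalar a 1 (ev1 f) = ev1 (T1 f).
Proof. by move=> f1 f2; apply: Tscalar_ev1 => //; apply/d2_eq0. Qed.

(** The factor tau_N in the last term restores what the tau_N-derivative removed, both in degree in
    z and in degree in tau_N. *)
Lemma T1_z f k : wle (wunit o1) 0 f -> wle (wunit o2) 1 f ->
  Tscalar a 1 (ev1 f * z k) =
    ev1 (T1 f + 2%:MP * f^`M(o0)) * z k
    + ev1 ((2 * a)%:MP * f + 2%:MP * ('X_o2 * f^`M(o2))).
Proof.
move=> f1 f2; rewrite TscalarM => [|s]; last by apply: ev_sym => j; exact: u1_sym.
have f1' : wle (wunit o1) 1 f by apply: wleW f1.
rewrite T1E // Tscalar_z // Gam1_z (mderiv_eq0 f1) (raddf0 ev1) /=.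
have -> : 4 * ac * 2^-1 = 2 * ac.
  apply: (mulIf (two_neq0 F N)); rewrite divfK ?two_neq0 //; ring.
rewrite !(evD, evM, evC, evX) ?constE /=.
by move: (ev1 _) (ev1 _) (ev1 _) (ev1 _) => *; ring.
Qed.

Lemma gen1_invariant v : Fspan G v -> Fspan G (Top a 1 v).
Proof.
apply: Top_Fspan; apply: gen1_elim => f s fn f1 f2; rewrite Top_sym_wave.
  apply: Fspan_wave_ext => [p|]; first exact: T1E.
  by apply: span1_const; rewrite /T1; weight_bound.
apply: Fspan_wave_ext => [p|]; first exact: T1_z.
apply: Fspan_waveD.
- by apply: span1_z1; rewrite /T1; weight_bound.
- by apply: span1_const; weight_bound.
Qed.
End EpsilonOne.

(* The factors 0 stand for the derivative with respect to [tau_(N-1)]. *)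
Lemma inverse_identity (L : fieldType) (x P S Q e0 e2 e r r' n c w : L) : x != 0 ->
  (2 * c * n * P * e + P * (r + r') +
   2 * (e0 * (S * P) + 0 * w + e2 * (n * (P * P)))) / x + P * e * (2 / x) +
  2 * (- (P * (x ^+ 2 * e0 + (x * Q - P) * 0 + P * x * e2) + P * x * e) / x ^+ 2) =
  P * (r + r' + (1 + 1) * c * n * e + (1 + 1) * (S * e0)
       + ((1 + 1) * n - (1 + 1)) * (P * e2)) / x + - (1 + 1) * (P * e0).
Proof. by move=> x0; field. Qed.

(** * The case epsilon = 2 *)

Section EpsilonTwo.
Variables (F : numFieldType) (N m : nat) (hN : (2 < N)%N) (n : int) (a : F).
Local Notation K := {fraction {mpoly F[N]}}.
Local Notation z := (@zF F N).
Local Notation ev2 := (ev (u2 F N)).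
Local Notation p1 := (pos1 hN).
Local Notation G := (@Defs.gen2 F N m hN n).
Implicit Types (f : {mpoly F[3]}) (s : Sigma F N m).
Let N1 : (1 < N)%N := ltnW hN.
Local Notation ac := (constF N a).
Local Notation P := ((tau F N N)%:F : K).

Definition v2 : 3.-tuple {mpoly F[2]} := [tuple 0; 'X_i0; 'X_i1].
Definition v2' : 2.-tuple {mpoly F[3]} := [tuple 'X_o1; 'X_o2].

Lemma narrow2 f : wle (wunit o0) 0 f ->
  (f \mPo v2) \mPo [tuple tau F N N.-1; tau F N N] = f \mPo u2 F N.
Proof.
move=> f0; apply: narrow_args f0 _.
by elim/I3_ind => //= _; rewrite /v2 /= comp_mpolyXU.
Qed.

Lemma narrow2_inv f : wle (wunit o1) 0 f ->
  (f \mPo v1 F) \mPo [tuple sigma F N 1; tau F N N] = f \mPo u2 F N.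
Proof.
move=> f0; apply: narrow_args f0 _.
by elim/I3_ind => //= _; rewrite /v1 /= comp_mpolyXU.
Qed.

Lemma span2_const f s : wle (W2 N) n f -> wle (wunit o0) 1 f -> wle (wunit o1) 1 f ->
  Fspan G (sym_wave (fun=> ev2 f) s).
Proof.
move=> fn f1 f2; apply: Fspan_gen.
have -> : sym_wave (fun=> ev2 f) s = ev2 f *: Lambda (tens 1 s).
  by rewrite Lambda_tens sym_waveZ; apply: sym_wave_ext => p; rewrite rmorph1 mulr1.
apply: Gen2f; [by rewrite inord3E; apply/d2_eq0 | by rewrite inord3E; apply/d2_eq0 |].
exact: deg_le_comp (@u2_hom F N) _ _ fn.
Qed.

Lemma span2_z1 f s : wle (W2 N) (n - 1) f -> wle (wunit o0) 0 f -> wle (wunit o1) 1 f ->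
  Fspan G (sym_wave (fun p => ev2 f * z (p p1)) s).
Proof.
move=> fn f1 f2; apply: Fspan_gen.
have -> : sym_wave (fun p => ev2 f * z (p p1)) s = ev2 f *: Lambda (tens (z p1) s).
  by rewrite Lambda_tens sym_waveZ; apply: sym_wave_ext => p; rewrite fperm_z.
rewrite /ev -narrow2 //; apply: Gen2g; last first.
  by rewrite narrow2 //; exact: deg_le_comp (@u2_hom F N) _ _ fn.
rewrite inord2E; apply/d2_eq0; apply: wle_comp f2.
by elim/I3_ind => /=; first [exact: wleX | exact: wle0].
Qed.

Lemma span2_inv f s : wle (W2 N) (n - N%:Z + 1) f -> wle (wunit o1) 0 f ->
  wle (wunit o0) 1 f ->
  Fspan G (sym_wave (fun p => P * ev2 f * (z (p p1))^-1) s).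
Proof.
move=> fn f1 f2; apply: Fspan_gen.
have -> : sym_wave (fun p => P * ev2 f * (z (p p1))^-1) s
    = (tau F N N * (f \mPo u2 F N))%:F *: Lambda (tens (z p1)^-1 s).
  rewrite Lambda_tens sym_waveZ; apply: sym_wave_ext => p.
  by rewrite tofracM fmorphV /= fperm_z.
rewrite -narrow2_inv //; apply: Gen2q; last first.
  by rewrite narrow2_inv //; exact: deg_le_comp (@u2_hom F N) _ _ fn.
rewrite inord2E; apply/d2_eq0; apply: wle_comp f2.
by elim/I3_ind => /=; first [exact: wleX | exact: wle0].
Qed.

Lemma gen2_elim (Pr : wave F N m -> Prop) :
  (forall f s, wle (W2 N) n f -> wle (wunit o0) 1 f -> wle (wunit o1) 1 f ->
     Pr (sym_wave (fun=> ev2 f) s)) ->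
  (forall f s, wle (W2 N) (n - 1) f -> wle (wunit o0) 0 f -> wle (wunit o1) 1 f ->
     Pr (sym_wave (fun p => ev2 f * z (p p1)) s)) ->
  (forall f s, wle (W2 N) (n - N%:Z + 1) f -> wle (wunit o0) 1 f ->
     wle (wunit o1) 0 f ->
     Pr (sym_wave (fun p => P * ev2 f * (z (p p1))^-1) s)) ->
  forall v, G v -> Pr v.
Proof.
move=> Hf Hg Hq v [f s fz f1 f2 fd|h s hz h1 hd|h s hz h1 hd].
- rewrite inord3E in f1; rewrite inord3E in f2.
  have [g [ge gd gs]] := truncation (@u2_hom F N) fd.
  rewrite Lambda_tens sym_waveZ (@sym_wave_ext _ _ _ _ (fun=> ev2 g)) => [|p].
    by apply: Hf => //; apply: (wle_sub gs); apply/d2_eq0.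
  by rewrite rmorph1 mulr1 /ev ge.
- have vu j : tnth v2' j \mPo u2 F N = tnth [tuple tau F N N.-1; tau F N N] j.
    by elim/I2_ind: j; rewrite /= comp_mpolyXU.
  have [g [ge gd gs]] := widen_args (@u2_hom F N) vu hd.
  rewrite Lambda_tens sym_waveZ.
  rewrite (@sym_wave_ext _ _ _ _ (fun p => ev2 g * z (p p1))) => [|p]; last first.
    by rewrite fperm_z ge.
  apply: Hg => //; apply: (wle_sub gs).
    apply: (@wle_comp _ _ _ (fun=> 0%N)); last exact: wle_zero.
    by elim/I2_ind => /=; exact: wleX.
  rewrite inord2E in h1; move/d2_eq0: h1; apply: wle_comp.
  by elim/I2_ind => /=; exact: wleX.
have vu j : tnth (v1' F) j \mPo u2 F N = tnth [tuple sigma F N 1; tau F N N] j.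
  by elim/I2_ind: j; rewrite /= comp_mpolyXU.
have [g [ge gd gs]] := widen_args (@u2_hom F N) vu hd.
rewrite Lambda_tens sym_waveZ.
rewrite (@sym_wave_ext _ _ _ _ (fun p => P * ev2 g * (z (p p1))^-1)) => [|p]; last first.
  by rewrite fmorphV /= fperm_z tofracM ge.
apply: Hq => //; apply: (wle_sub gs); last first.
  apply: (@wle_comp _ _ _ (fun=> 0%N)); last exact: wle_zero.
  by elim/I2_ind => /=; exact: wleX.
rewrite inord2E in h1; move/d2_eq0: h1; apply: wle_comp.
by elim/I2_ind => /=; exact: wleX.
Qed.

Definition T2 := Tpoly (alpha2 N a) (beta2 F N).

Lemma T2E f : wle (wunit o0) 1 f -> wle (wunit o1) 1 f ->
  Tscalar a 2 (ev2 f) = ev2 (T2 f).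
Proof. by move=> f1 f2; apply: Tscalar_ev2 => //; apply/d2_eq0. Qed.

(** In the last term tau_N replaces a tau_(N-1). This raises the degree in z by one, which the gap
    between the bounds n-1 and n absorbs. *)
Lemma T2_z f k : wle (wunit o0) 0 f -> wle (wunit o1) 1 f ->
  Tscalar a 2 (ev2 f * z k) =
    ev2 (T2 f + (4 * a)%:MP * f + 2%:MP * ('X_o1 * f^`M(o1)) + 2%:MP * ('X_o2 * f^`M(o2)))
      * z k
    + ev2 ((- 2)%:MP * ('X_o2 * f^`M(o1))).
Proof.
move=> f0 f1; rewrite TscalarM => [|s]; last by apply: ev_sym => j; exact: u2_sym.
have f0' : wle (wunit o0) 1 f by apply: wleW f0.
rewrite T2E // Tscalar_z // Gam2_z // (mderiv_eq0 f0) (raddf0 ev2) /=.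
rewrite !(evD, evM, evC, evX) ?constE /=.
by move: (ev2 _) (ev2 _) (ev2 _) (ev2 _) => *; ring.
Qed.

(** T(1/z_k) = 2/z_k cancels against twice the pairing of tau_N with 1/z_k. The last term has degree
    at most (n-N+1) - 1 + N = n. *)
Lemma T2_inv f k : wle (wunit o0) 1 f -> wle (wunit o1) 0 f ->
  Tscalar a 2 (P * ev2 f * (z k)^-1) =
    P * ev2 (T2 f + (2 * a * N%:R)%:MP * f + 2%:MP * ('X_o0 * f^`M(o0))
             + (2 * N%:R - 2)%:MP * ('X_o2 * f^`M(o2))) * (z k)^-1
    + ev2 ((- 2)%:MP * ('X_o2 * f^`M(o0))).
Proof.
move=> f0 f1; have f1' : wle (wunit o1) 1 f by apply: wleW f1.
have Ps (g : 'S_N) : fperm g P = P by rewrite fperm_tofrac tau_sym.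
have es (g : 'S_N) : fperm g (ev2 f) = ev2 f by apply: ev_sym => j; exact: u2_sym.
rewrite TscalarM => [|g]; last by rewrite fpermM Ps es.
rewrite (TscalarM _ _ _ Ps) Tscalar2_tauN // T2E // Tscalar_inv //.
rewrite Gam_zV !(GamC 2 _ (z k)) GamM !(GamC 2 (z k)) Gam2_z // Gam_z.
rewrite z2_fderiv_tauN // Gam_ev sumI3 /= (mderiv_eq0 f1) (raddf0 ev2).
rewrite Gam2_NN (GamC 2 P) Gam2_1N.
rewrite !(evD, evM, evC, evX) ?constE /=.
exact: inverse_identity (z_neq0 F k).
Qed.

Lemma gen2_invariant v : Fspan G v -> Fspan G (Top a 2 v).
Proof.
apply: Top_Fspan; apply: gen2_elim => f s fn f0 f1; rewrite Top_sym_wave.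
- apply: Fspan_wave_ext => [p|]; first exact: T2E.
  by apply: span2_const; rewrite /T2; weight_bound.
- apply: Fspan_wave_ext => [p|]; first exact: T2_z.
  apply: Fspan_waveD.
  + by apply: span2_z1; rewrite /T2; weight_bound.
  + by apply: span2_const; weight_bound.
apply: Fspan_wave_ext => [p|]; first exact: T2_inv.
apply: Fspan_waveD.
- by apply: span2_inv; rewrite /T2; weight_bound.
- by apply: span2_const; weight_bound.
Qed.
End EpsilonTwo.

Unset Implicit Arguments.
Local Open Scope complex_scope.

Theorem theorem1 (R : realType) (N : nat) (hN : (2 < N)%N) (m : nat)
    (a : R) (ha : 2^-1 < a) (eps : 'I_3) (n : nat) (phi : wave R[i] N m) :
  Tspace hN eps n phi -> Tspace hN eps n (Top a%:C eps phi).
Proof.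
elim/I3_ind: eps; [exact: gen0_invariant | exact: gen1_invariant | exact: gen2_invariant].
Qed.
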